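(* Let $k$ be an algebraically closed field, $X$ an irreducible smooth projective curve over $k$, $S\subset X$ a finite subset, and $m\geq 0$ an integer. Let $E$ be a vector bundle on $X$ and let $D\colon E\to E\otimes K_X\otimes\mathcal{O}_X(mS)$ be a singular connection on $E$ with poles of order $m$ on $S$. Then there is a unique maximal coherent subsheaf $F\subset E$ on which $D$ induces a (nonsingular) connection, i.e. a unique maximal element among the coherent subsheaves $F\subset E$ satisfying $D(F)\subset F\otimes K_X\subset E\otimes K_X\otimes\mathcal{O}_X(mS)$.
   Context: The characteristic of $k$ is arbitrary. $K_X$ is the cotangent bundle of $X$; the reduced effective divisor $\sum_{x\in S}x$ is also denoted $S$. Vector bundle means locally free sheaf of finite rank. A (nonsingular) connection on $E$ is a differential operator of order one ($k$-linear map of sheaves) $D\colon E\to E\otimes K_X$ such that $D(fs)=fD(s)+s\otimes df$ for all locally defined functions $f$ on $X$ and locally defined sections $s$ of $E$. A singular connection on $E$ with poles of order $m$ on $S$ is a differential operator of order one $D\colon E\to E\otimes K_X\otimes\mathcal{O}_X(mS)$ satisfying the same Leibniz identity. The zero subsheaf is allowed: $F$ may be $0$. *)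

(* Defs.v *)
From HB Require Import structures.
From mathcomp Require Import all_boot all_order all_algebra.
From mathcomp Require Import boolp classical_sets functions cardinality.
From mathcomp Require Import mpoly.

Set Implicit Arguments.
Unset Strict Implicit.
Unset Printing Implicit Defensive.
Import GRing.Theory.
Local Open Scope classical_set_scope.
Local Open Scope ring_scope.

(* makes U x meaningful when U has a coercion to set T *)
Identity Coercion fun_of_set : set >-> Funclass.

(* Varieties are sets of closed points, in the language of Serre's FAC.  Since
   k is algebraically closed, passing from a variety over k to its set of
   closed points changes neither the lattice of open sets, nor the structure
   sheaf, nor the sheaves of modules. *)

(* P^n(k): each line of k^(n+1) is represented by its generator whose first
   nonzero coordinate is 1. *)
Definition normalized (k : closedFieldType) (n : nat) (v : 'rV[k]_n.+1) : bool :=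
  [exists i, (v 0 i == 1) && [forall j : 'I_n.+1, (j < i)%N ==> (v 0 j == 0)]].

Definition proj (k : closedFieldType) (n : nat) : Type :=
  {v : 'rV[k]_n.+1 | normalized v}.

Section ProjectiveSpace.
Variables (k : closedFieldType) (n : nat).
Implicit Types (A Z : set (proj k n)) (p q : {mpoly k[n.+1]}).

Definition peval p (x : proj k n) : k := p.@[fun i => sval x 0 i].

Definition zclosed Z : Prop :=
  exists P : set {mpoly k[n.+1]},
    (forall p, P p -> exists d, p \is d.-homog) /\
    Z = [set x | forall p, P p -> peval p x = 0].

Definition zopen A : Prop := zclosed (~` A).

Definition irreducible A : Prop :=
  A !=set0 /\ forall Z1 Z2, zclosed Z1 -> zclosed Z2 ->
    A `<=` Z1 `|` Z2 -> A `<=` Z1 \/ A `<=` Z2.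

Definition has_irreducible_chain A (d : nat) : Prop :=
  exists Z : nat -> set (proj k n),
    (forall i, (i <= d)%N -> [/\ zclosed (Z i), irreducible (Z i) & Z i `<=` A]) /\
    (forall i, (i < d)%N -> Z i `<` Z i.+1).

(* Krull dimension of a Zariski closed set A *)
Definition has_dimension A (d : nat) : Prop :=
  has_irreducible_chain A d /\ ~ has_irreducible_chain A d.+1.

(* The homogeneous ideal of A: the polynomials vanishing on the affine cone
   over A.  As k is infinite this ideal is generated by homogeneous
   polynomials. *)
Definition vanishing_ideal A : set {mpoly k[n.+1]} :=
  [set p | forall x, A x -> forall c : k, p.@[fun i => c * sval x 0 i] = 0].

(* Jacobian criterion, with homogeneous coordinates: at every point the
   Jacobian matrix of a family of generators of the ideal has rank n - d. *)
Definition smooth_of_dimension A (d : nat) : Prop :=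
  exists (r : nat) (f : 'I_r -> {mpoly k[n.+1]}),
    (forall p, vanishing_ideal A p <->
       exists c : 'I_r -> {mpoly k[n.+1]}, p = \sum_i c i * f i) /\
    (forall x, A x ->
       (\rank (\matrix_(i < r, j < n.+1) peval (f i)^`M(j) x) + d)%N = n).

Definition regular A (f : A -> k) : Prop :=
  forall x : A, exists2 W, zopen W & W (val x) /\
    exists (d : nat) (p q : {mpoly k[n.+1]}), [/\ p \is d.-homog, q \is d.-homog &
      forall y : A, W (val y) ->
        peval q (val y) != 0 /\ f y = peval p (val y) / peval q (val y)].

Lemma zclosedU Z1 Z2 : zclosed Z1 -> zclosed Z2 -> zclosed (Z1 `|` Z2).
Proof.
move=> [P1 [h1 ->]] [P2 [h2 ->]].
exists [set r | exists p q, [/\ P1 p, P2 q & r = p * q]]; split.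
  move=> _ [p [q [/h1 [d hd] /h2 [e he] ->]]].
  by exists (d + e)%N; apply: dhomogM.
apply/seteqP; split=> x /=.
  move=> H _ [p [q [Pp Pq ->]]]; rewrite /peval mevalM.
  by case: H => [/(_ _ Pp)|/(_ _ Pq)]; rewrite /peval => ->; rewrite ?mul0r ?mulr0.
move=> H; apply: contrapT => /not_orP[/existsNP[p /not_implyP[Pp /eqP np]]].
move=> /existsNP[q /not_implyP[Pq /eqP nq]].
have /eqP := H _ (ex_intro _ p (ex_intro _ q (And3 Pp Pq erefl))).
by rewrite /peval mevalM mulf_eq0 (negPf np) (negPf nq).
Qed.

Lemma zopenI A B : zopen A -> zopen B -> zopen (A `&` B).
Proof. by rewrite /zopen setCI; exact: zclosedU. Qed.

Lemma zopenT : zopen setT.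
Proof.
rewrite /zopen setCT; exists [set 1]; split.
  by move=> p ->; exists 0%N; apply: dhomog1.
apply/seteqP; split=> x //= /(_ 1 erefl) /eqP.
by rewrite /peval meval1 oner_eq0.
Qed.

Lemma regular_cst A (c : k) : regular (fun _ : A => c).
Proof.
move=> x; exists setT; first exact: zopenT.
split=> //; exists 0%N, (c *: 1), 1; split.
- by apply/dhomogZ/dhomog1.
- exact: dhomog1.
- by move=> y _; rewrite /peval mevalZ !meval1 oner_neq0 mulr1 divr1.
Qed.

Lemma regularB A (f g : A -> k) : regular f -> regular g -> regular (f - g).
Proof.
move=> hf hg x; have [W1 oW1 [W1x [d [p [q [hp hq H1]]]]]] := hf x.
have [W2 oW2 [W2x [e [p' [q' [hp' hq' H2]]]]]] := hg x.
exists (W1 `&` W2); [exact: zopenI|split=> //].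
exists (d + e)%N, (p * q' - q * p'), (q * q'); split.
- by rewrite rpredB //; apply: dhomogM.
- exact: dhomogM.
- move=> y [/H1[q0 fE] /H2[q0' gE]].
  rewrite /peval mevalB !mevalM -!/(peval _ _) mulf_neq0 //; split=> //.
  rewrite [LHS]/(f y - g y) fE gE mulrBl -!mulf_div.
  by rewrite (divff q0) (divff q0') mulr1 mul1r.
Qed.

Lemma regularM A (f g : A -> k) : regular f -> regular g -> regular (f * g).
Proof.
move=> hf hg x; have [W1 oW1 [W1x [d [p [q [hp hq H1]]]]]] := hf x.
have [W2 oW2 [W2x [e [p' [q' [hp' hq' H2]]]]]] := hg x.
exists (W1 `&` W2); [exact: zopenI|split=> //].
exists (d + e)%N, (p * p'), (q * q'); split; [exact: dhomogM|exact: dhomogM|].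
move=> y [/H1[q0 fE] /H2[q0' gE]].
rewrite /peval !mevalM -!/(peval _ _) mulf_neq0 //; split=> //.
by rewrite [LHS]/(f y * g y) fE gE -mulf_div.
Qed.

Lemma regular_sub A B (AB : A `<=` B) (f : B -> k) :
  regular f -> regular (f \o subfun AB).
Proof.
move=> hf x; have [W oW [Wx [d [p [q [hp hq H]]]]]] := hf (subfun AB x).
by exists W => //; split=> //; exists d, p, q; split=> // y Wy; exact: (H (subfun AB y)).
Qed.

(* Regularity is local for the topology induced on A. *)
Lemma regular_local A (f : A -> k) :
  (forall x : A, exists (B : set (proj k n)) (BA : B `<=` A),
     [/\ B (val x), exists2 W, zopen W & B = A `&` W
       & regular (f \o subfun BA)]) ->
  regular f.
Proof.
move=> H x; have [B [BA [Bx [W oW BE] hf]]] := H x.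
have [W' oW' [W'x [d [p [q [hp hq HW]]]]]] := hf (SigSub (mem_set Bx)).
exists (W `&` W'); first exact: zopenI.
split; first by split=> //; move: (Bx); rewrite [X in X _]BE => -[].
exists d, p, q; split=> // y [Wy W'y].
have By : B (val y) by rewrite BE; split=> //; exact: set_valP.
have := HW (SigSub (mem_set By)) W'y.
by rewrite /= (_ : subfun BA _ = y) //; apply: val_inj.
Qed.

Section RegularFunctions.
Variable A : set (proj k n).

Definition regular_pred : {pred A -> k} := fun f => `[< regular f >].

Lemma regular_subring_closed : subring_closed regular_pred.
Proof.
split; first by apply/asboolP; apply: regular_cst.
- by move=> f g /asboolP hf /asboolP hg; apply/asboolP; apply: regularB.
- by move=> f g /asboolP hf /asboolP hg; apply/asboolP; apply: regularM.
Qed.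

HB.instance Definition _ :=
  GRing.isSubringClosed.Build (A -> k) regular_pred regular_subring_closed.

Record regfun : Type := RegFun
  { regval :> A -> k; regvalP : regval \in regular_pred }.

HB.instance Definition _ := [isSub for regval].
HB.instance Definition _ := [Choice of regfun by <:].
HB.instance Definition _ := GRing.SubChoice_isSubComPzRing.Build
  (A -> k) regular_pred regfun regular_subring_closed.

Definition regcst (c : k) : regfun := RegFun (asboolT (@regular_cst A c)).

End RegularFunctions.

Definition regres A B (AB : A `<=` B) (f : regfun B) : regfun A :=
  RegFun (asboolT (regular_sub AB (asboolW (regvalP f)))).

Section Restriction.
Variables (A B : set (proj k n)) (AB : A `<=` B).

Lemma regresB : {morph regres AB : f g / f - g}.
Proof. by move=> f g; apply: val_inj. Qed.

Lemma regresM : monoid_morphism (regres AB).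
Proof. by split=> [|f g]; apply: val_inj. Qed.

HB.instance Definition _ :=
  GRing.isZmodMorphism.Build (regfun B) (regfun A) (regres AB) regresB.
HB.instance Definition _ :=
  GRing.isMonoidMorphism.Build (regfun B) (regfun A) (regres AB) regresM.

End Restriction.

Lemma regres_comp A B C (AB : A `<=` B) (BC : B `<=` C) (AC : A `<=` C) f :
  regres AB (regres BC f) = regres AC f.
Proof.
apply: val_inj; apply: funext => x /=; congr (regval f _); exact: val_inj.
Qed.

Lemma regres_id A (AA : A `<=` A) f : regres AA f = f.
Proof.
apply: val_inj; apply: funext => x /=; congr (regval f _); exact: val_inj.
Qed.

End ProjectiveSpace.

Record smooth_projective_curve (k : closedFieldType) (n : nat) : Type := Curve {
  curve_set :> set (proj k n);
  curve_closed : zclosed curve_set;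
  curve_irreducible : irreducible curve_set;
  curve_dimension : has_dimension curve_set 1;
  curve_smooth : smooth_of_dimension curve_set 1
}.

Section Sheaves.
Variables (k : closedFieldType) (n : nat) (X : smooth_projective_curve k n).

Record opens : Type := Opens {
  opens_set :> set (proj k n);
  opensP : exists2 Z, zclosed Z & opens_set = X `\` Z
}.

Lemma opensI_subproof (U V : opens) :
  exists2 Z, zclosed Z & U `&` V = X `\` Z.
Proof.
have [Z1 cZ1 ->] := opensP U; have [Z2 cZ2 ->] := opensP V.
exists (Z1 `|` Z2); first exact: zclosedU.
by rewrite setDUr.
Qed.

Definition opensI (U V : opens) : opens := Opens (opensI_subproof U V).

Definition locally (U : opens) (P : forall V : opens, V `<=` U -> Prop) : Prop :=
  forall x, U x -> exists (V : opens) (VU : V `<=` U), V x /\ P V VU.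

(* Sheaves of O_X-modules *)
Record sheaf : Type := Sheaf {
  sections :> forall U : opens, lmodType (regfun U);
  res : forall (U V : opens), V `<=` U -> sections U -> sections V;
  resD : forall (U V : opens) (VU : V `<=` U) s t,
    res VU (s + t) = res VU s + res VU t;
  resZ : forall (U V : opens) (VU : V `<=` U) (f : regfun U) s,
    res VU (f *: s) = regres VU f *: res VU s;
  res_id : forall (U : opens) (UU : U `<=` U) s, res UU s = s;
  res_comp : forall (U V W : opens) (VU : V `<=` U) (WV : W `<=` V)
    (WU : W `<=` U) s, res WV (res VU s) = res WU s;
  sheaf_separated : forall (U : opens) (s t : sections U),
    locally (fun V VU => res VU s = res VU t) -> s = t;
  sheaf_glue : forall (U : opens) (I : Type) (V : I -> opens)
    (VU : forall i, V i `<=` U) (s : forall i, sections (V i)),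
    (forall x, U x -> exists i, V i x) ->
    (forall i j (W : opens) (Wi : W `<=` V i) (Wj : W `<=` V j),
       res Wi (s i) = res Wj (s j)) ->
    exists t, forall i, res (VU i) t = s i
}.

Record sheaf_morphism (M N : sheaf) : Type := SheafMorphism {
  mor :> forall U : opens, {linear M U -> N U};
  mor_res : forall (U V : opens) (VU : V `<=` U) s,
    mor V (res VU s) = res VU (mor U s)
}.

Record bilinear_pairing (M N P : sheaf) : Type := BilinearPairing {
  pairing :> forall U : opens, M U -> N U -> P U;
  pairing_linearl : forall (U : opens) (f : regfun U) s s' t,
    pairing (f *: s + s') t = f *: pairing s t + pairing s' t;
  pairing_linearr : forall (U : opens) (f : regfun U) s t t',
    pairing s (f *: t + t') = f *: pairing s t + pairing s t';
  pairing_res : forall (U V : opens) (VU : V `<=` U) s t,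
    pairing (res VU s) (res VU t) = res VU (pairing s t)
}.

(* M (x) N, given by its universal property, hence up to unique isomorphism *)
Record tensor_product (M N : sheaf) : Type := TensorProduct {
  tensor_sheaf :> sheaf;
  tens : bilinear_pairing M N tensor_sheaf;
  tensor_universal : forall (P : sheaf) (b : bilinear_pairing M N P),
    exists h : sheaf_morphism tensor_sheaf P,
      (forall U s t, h U (tens U s t) = b U s t) /\
      forall h' : sheaf_morphism tensor_sheaf P,
        (forall U s t, h' U (tens U s t) = b U s t) ->
        forall U w, h' U w = h U w
}.

(* k-linear derivations of O_X *)
Record derivation (M : sheaf) : Type := Derivation {
  der :> forall U : opens, regfun U -> M U;
  derD : forall (U : opens) (f g : regfun U), der (f + g) = der f + der g;
  derM : forall (U : opens) (f g : regfun U),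
    der (f * g) = f *: der g + g *: der f;
  der_cst : forall (U : opens) (c : k), der (regcst U c) = 0;
  der_res : forall (U V : opens) (VU : V `<=` U) f,
    der (regres VU f) = res VU (der f)
}.

(* K_X, the sheaf of Kaehler differentials: the target of the universal
   k-linear derivation of O_X, hence given up to unique isomorphism *)
Record cotangent_bundle : Type := CotangentBundle {
  cotangent_sheaf :> sheaf;
  diff : derivation cotangent_sheaf;
  cotangent_universal : forall (M : sheaf) (d : derivation M),
    exists h : sheaf_morphism cotangent_sheaf M,
      (forall U f, h U (diff U f) = d U f) /\
      forall h' : sheaf_morphism cotangent_sheaf M,
        (forall U f, h' U (diff U f) = d U f) ->
        forall U w, h' U w = h U w
}.

Definition vector_bundle (E : sheaf) : Prop :=
  forall x, X x -> exists2 U : opens, U x &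
    exists (r : nat) (e : 'I_r -> E U),
      forall (V : opens) (VU : V `<=` U) (s : E V),
        exists! c : {ffun 'I_r -> regfun V}, s = \sum_i c i *: res VU (e i).

Section Subsheaves.
Variable E : sheaf.

(* O_X-submodules of E *)
Record subsheaf : Type := Subsheaf {
  subsections :> forall U : opens, set (E U);
  subsheaf0 : forall U : opens, subsections (0 : E U);
  subsheafD : forall (U : opens) (s t : E U),
    subsections s -> subsections t -> subsections (s + t);
  subsheafZ : forall (U : opens) (f : regfun U) (s : E U),
    subsections s -> subsections (f *: s);
  subsheaf_res : forall (U V : opens) (VU : V `<=` U) (s : E U),
    subsections s -> subsections (res VU s);
  subsheaf_local : forall (U : opens) (s : E U),
    locally (fun V VU => subsections (res VU s)) -> subsections s
}.

Definition subsheaf_le (F G : subsheaf) : Prop :=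
  forall U : opens, F U `<=` G U.

Definition finite_type (F : subsheaf) : Prop :=
  forall x, X x -> exists2 U : opens, U x &
    exists (r : nat) (s : 'I_r -> E U), (forall i, F U (s i)) /\
      forall (V : opens) (VU : V `<=` U) (t : E V), F V t ->
        locally (fun W (WV : W `<=` V) => exists c : 'I_r -> regfun W,
          res WV t = \sum_i c i *: res WV (res VU (s i))).

(* for all sections s_1, ..., s_r of F over U, the kernel of the morphism
   O_U^r -> F|_U they define is of finite type *)
Definition finite_type_relations (F : subsheaf) : Prop :=
  forall (U : opens) (r : nat) (s : 'I_r -> E U), (forall i, F U (s i)) ->
    locally (fun V (VU : V `<=` U) =>
      exists (q : nat) (rho : 'I_q -> 'I_r -> regfun V),
        (forall j, \sum_i rho j i *: res VU (s i) = 0) /\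
        forall (W : opens) (WV : W `<=` V) (c : 'I_r -> regfun W),
          \sum_i c i *: res WV (res VU (s i)) = 0 ->
          locally (fun W' (W'W : W' `<=` W) => exists b : 'I_q -> regfun W',
            forall i, regres W'W (c i) =
              \sum_j b j * regres W'W (regres WV (rho j i)))).

Definition coherent (F : subsheaf) : Prop :=
  finite_type F /\ finite_type_relations F.

Definition maximal_subsheaf (P : subsheaf -> Prop) (F : subsheaf) : Prop :=
  P F /\ forall G, P G -> subsheaf_le F G -> subsheaf_le G F.

End Subsheaves.

Section Poles.
Variables (S : set (proj k n)) (m : nat).

Lemma subDS (A B : set (proj k n)) : A `<=` B -> A `\` S `<=` B `\` S.
Proof. by move=> AB x [Ax nSx]; split=> //; exact: AB. Qed.

(* t generates the ideal sheaf of the reduced divisor S over V *)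
Definition local_equation (V : opens) (t : regfun V) : Prop :=
  forall (W : opens) (WV : W `<=` V) (f : regfun W),
    (forall y : W, S (val y) -> f y = 0) <-> exists u, f = u * regres WV t.

(* for every local equation t of S over V, the function t ^+ m * f, which is
   defined outside S, extends near every point of V to a regular function *)
Definition poles_bounded (U : opens) (f : regfun (U `\` S)) : Prop :=
  forall (V : opens) (VU : V `<=` U) (t : regfun V), local_equation t ->
    locally (fun W (WV : W `<=` V) => exists g : regfun W,
      forall y : W `\` S, g (subfun (@subDsetl _ W S) y) =
        t (subfun (subset_trans (@subDsetl _ W S) WV) y) ^+ m *
        f (subfun (subDS (subset_trans WV VU)) y)).

Lemma poles_bounded0 (U : opens) : poles_bounded (0 : regfun (U `\` S)).
Proof.
move=> V VU t _ x Vx; exists V, (@subset_refl _ V); split=> //.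
by exists 0 => y; rewrite mulr0.
Qed.

Lemma poles_boundedB (U : opens) (f g : regfun (U `\` S)) :
  poles_bounded f -> poles_bounded g -> poles_bounded (f - g).
Proof.
move=> hf hg V VU t ht x Vx.
have [W1 [W1V [W1x [g1 E1]]]] := hf V VU t ht x Vx.
have [W2 [W2V [W2x [g2 E2]]]] := hg V VU t ht x Vx.
have WW1 : opensI W1 W2 `<=` W1 by apply: subIsetl.
have WW2 : opensI W1 W2 `<=` W2 by apply: subIsetr.
exists (opensI W1 W2), (subset_trans WW1 W1V); split=> //.
exists (regres WW1 g1 - regres WW2 g2) => y.
have := E2 (subfun (subDS WW2) y); have := E1 (subfun (subDS WW1) y).
set u := _ ^+ m => F1; set v := _ ^+ m => F2; set w := _ ^+ m.
have -> : w = u by congr (regval t _ ^+ m); exact: val_inj.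
rewrite [RHS]mulrBr; congr (_ - _).
- rewrite /= (_ : subfun WW1 _ = subfun (@subDsetl _ _ S) (subfun (subDS WW1) y)).
    by rewrite F1; congr (_ * regval f _); exact: val_inj.
  exact: val_inj.
- rewrite /= (_ : subfun WW2 _ = subfun (@subDsetl _ _ S) (subfun (subDS WW2) y)).
    rewrite F2; congr (_ * regval g _); last exact: val_inj.
    by congr (regval t _ ^+ m); exact: val_inj.
  exact: val_inj.
Qed.

Lemma poles_boundedZ (U : opens) (a : regfun U) (f : regfun (U `\` S)) :
  poles_bounded f -> poles_bounded (regres (@subDsetl _ U S) a * f).
Proof.
move=> hf V VU t ht x Vx; have [W [WV [Wx [g E]]]] := hf V VU t ht x Vx.
exists W, WV; split=> //; exists (regres (subset_trans WV VU) a * g) => y.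
have /= := E y; set v := regval t _ => F.
rewrite [LHS]/(regval a _ * regval g _) F [RHS]mulrCA.
congr (regval a _ * _).
exact: val_inj.
Qed.

Lemma poles_bounded_res (U V : opens) (VU : V `<=` U) (f : regfun (U `\` S)) :
  poles_bounded f -> poles_bounded (regres (subDS VU) f).
Proof.
move=> hf V' V'V t ht x V'x.
have [W [WV' [Wx [g E]]]] := hf V' (subset_trans V'V VU) t ht x V'x.
exists W, WV'; split=> //; exists g => y; rewrite E /=; congr (_ * regval f _).
exact: val_inj.
Qed.

Lemma local_equation_res (U V : opens) (VU : V `<=` U) (t : regfun U) :
  local_equation t -> local_equation (regres VU t).
Proof.
move=> ht W WV f; rewrite (ht W (subset_trans WV VU)).
by split=> -[u ->]; exists u; rewrite (regres_comp _ _ (subset_trans WV VU)).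
Qed.

Section PolesModule.
Variable U : opens.

Definition poles_pred : {pred regfun (U `\` S)} := fun f => `[< poles_bounded f >].

Lemma poles_zmod_closed : zmod_closed poles_pred.
Proof.
split=> [|f g /asboolP hf /asboolP hg]; apply/asboolP.
  exact: poles_bounded0.
exact: poles_boundedB.
Qed.

HB.instance Definition _ :=
  GRing.isZmodClosed.Build (regfun (U `\` S)) poles_pred poles_zmod_closed.

Record poles : Type := Poles
  { polesval :> regfun (U `\` S); polesvalP : polesval \in poles_pred }.

HB.instance Definition _ := [isSub for polesval].
HB.instance Definition _ := [Choice of poles by <:].
HB.instance Definition _ := GRing.SubChoice_isSubZmodule.Build
  (regfun (U `\` S)) poles_pred poles poles_zmod_closed.

Definition poles_scale (a : regfun U) (f : poles) : poles :=
  Poles (asboolT (poles_boundedZ a (asboolW (polesvalP f)))).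

Lemma poles_scaleA a b f : poles_scale a (poles_scale b f) = poles_scale (a * b) f.
Proof. by apply: val_inj; rewrite /= rmorphM mulrA. Qed.

Lemma poles_scale1 : left_id 1 poles_scale.
Proof. by move=> f; apply: val_inj; rewrite /= rmorph1 mul1r. Qed.

Lemma poles_scaleDr : right_distributive poles_scale +%R.
Proof. by move=> a f g; apply: val_inj; rewrite /= mulrDr. Qed.

Lemma poles_scaleDl f : {morph poles_scale^~ f : a b / a + b}.
Proof. by move=> a b; apply: val_inj; rewrite /= rmorphD mulrDl. Qed.

HB.instance Definition _ := GRing.Zmodule_isLmodule.Build (regfun U) poles
  poles_scaleA poles_scale1 poles_scaleDr poles_scaleDl.

End PolesModule.

Definition poles_res (U V : opens) (VU : V `<=` U) (f : poles U) : poles V :=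
  Poles (asboolT (poles_bounded_res VU (asboolW (polesvalP f)))).

Lemma poles_resD (U V : opens) (VU : V `<=` U) (f g : poles U) :
  poles_res VU (f + g) = poles_res VU f + poles_res VU g.
Proof. by apply: val_inj; rewrite /= rmorphD. Qed.

Lemma poles_resZ (U V : opens) (VU : V `<=` U) (a : regfun U) (f : poles U) :
  poles_res VU (a *: f) = regres VU a *: poles_res VU f.
Proof.
apply: val_inj; rewrite /= rmorphM /=; congr (_ * _).
apply: val_inj; apply: funext => y /=; congr (regval a _); exact: val_inj.
Qed.

Lemma poles_res_id (U : opens) (UU : U `<=` U) (f : poles U) : poles_res UU f = f.
Proof. by apply: val_inj; rewrite /= regres_id. Qed.

Lemma poles_res_comp (U V W : opens) (VU : V `<=` U) (WV : W `<=` V)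
  (WU : W `<=` U) (f : poles U) :
  poles_res WV (poles_res VU f) = poles_res WU f.
Proof. by apply: val_inj; rewrite /= (regres_comp _ _ (subDS WU)). Qed.

Lemma poles_separated (U : opens) (f g : poles U) :
  locally (fun V (VU : V `<=` U) => poles_res VU f = poles_res VU g) -> f = g.
Proof.
move=> H; do 2![apply: val_inj => /=]; apply: funext => y.
have [Uy nSy] := set_valP y; have [V [VU [Vy /(congr1 val)/(congr1 val)/= E]]] := H _ Uy.
have Dy : (V `\` S) (val y) by [].
have := congr1 (fun h => h (SigSub (mem_set Dy))) E; rewrite /=.
by rewrite (_ : subfun _ _ = y) //; exact: val_inj.
Qed.

Lemma poles_glue (U : opens) (I : Type) (V : I -> opens)
    (VU : forall i, V i `<=` U) (s : forall i, poles (V i)) :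
    (forall x, U x -> exists i, V i x) ->
    (forall i j (W : opens) (Wi : W `<=` V i) (Wj : W `<=` V j),
       poles_res Wi (s i) = poles_res Wj (s j)) ->
  exists t, forall i, poles_res (VU i) t = s i.
Proof.
move=> cov compat.
have compatE i j (y : V i `\` S) (z : V j `\` S) : val y = val z -> s i y = s j z.
  move=> yz; have [Viy nSy] := set_valP y; have [Vjz _] := set_valP z.
  have Wi : opensI (V i) (V j) `<=` V i by apply: subIsetl.
  have Wj : opensI (V i) (V j) `<=` V j by apply: subIsetr.
  have Dy : (opensI (V i) (V j) `\` S) (val y) by split=> //; split=> //; rewrite yz.
  have /(congr1 val)/(congr1 val)/= E := compat i j _ Wi Wj.
  have := congr1 (fun h => h (SigSub (mem_set Dy))) E; rewrite /=.
  rewrite (_ : subfun _ _ = y); last exact: val_inj.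
  by rewrite (_ : subfun _ _ = z) //; exact: val_inj.
have covS (y : U `\` S) : {i | (V i `\` S) (val y)}.
  apply: cid; have [Uy nSy] := set_valP y.
  by have [i Viy] := cov _ Uy; exists i.
pose idx y := sval (covS y).
have idxP y : (V (idx y) `\` S) (val y) := svalP (covS y).
pose pt (y : U `\` S) : V (idx y) `\` S := SigSub (mem_set (idxP y)).
pose f (y : U `\` S) : k := s (idx y) (pt y).
have fE i (y : V i `\` S) : f (subfun (subDS (VU i)) y) = s i y by exact: compatE.
have fi i : f \o subfun (subDS (VU i)) = s i by apply: funext => y; exact: fE.
have rf : regular f.
  apply: regular_local => y; have [i Viy] := covS y.
  exists (V i `\` S), (subDS (VU i)); split=> //.
  - have [Z cZ ViE] := opensP (V i); exists (~` Z); first by rewrite /zopen setCK.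
    apply/seteqP; split=> z [].
      by move=> Vz nSz; split; [split=> //; exact: VU Vz|move: Vz; rewrite ViE => -[]].
    move=> [Uz nSz] nZz; split=> //; rewrite ViE; split=> //.
    by have [Z' _ UE] := opensP U; move: Uz; rewrite UE => -[].
  - by rewrite fi; apply: asboolW (regvalP (s i)).
pose F : regfun (U `\` S) := RegFun (asboolT rf).
have bF : poles_bounded F.
  move=> V' V'U t ht x V'x; have [i Vix] := cov x (V'U x V'x).
  have TV : opensI V' (V i) `<=` V' by apply: subIsetl.
  have TVi : opensI V' (V i) `<=` V i by apply: subIsetr.
  have [|W [WT [Wx [g E]]]] := asboolW (polesvalP (s i)) _ TVi _
    (local_equation_res TV ht) x; first by [].
  exists W, (subset_trans WT TV); split=> //; exists g => y; rewrite E /=.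
  rewrite -fE; congr (regval t _ ^+ m * f _); exact: val_inj.
exists (Poles (asboolT bF)) => i; do 2![apply: val_inj => /=]; exact: fi.
Qed.

(* O_X(mS) *)
Definition sheaf_of_poles : sheaf :=
  Sheaf poles_resD poles_resZ poles_res_id poles_res_comp poles_separated poles_glue.

Lemma poles_bounded1 (U : opens) : poles_bounded (1 : regfun (U `\` S)).
Proof.
move=> V VU t _ x Vx; exists V, (@subset_refl _ V); split=> //.
exists (t ^+ m) => y; rewrite -[X in _ * X]/(1 : k) mulr1.
have expE j (z : V) : (t ^+ j) z = t z ^+ j.
  by elim: j => [|j IH]; rewrite ?expr0 // !exprS -IH.
by rewrite expE; congr (regval t _ ^+ m); exact: val_inj.
Qed.

(* the section 1 of O_X(mS) *)
Definition poles1 (U : opens) : sheaf_of_poles U := Poles (asboolT (@poles_bounded1 U)).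

End Poles.

Section Connections.
Variables (S : set (proj k n)) (m : nat) (K : cotangent_bundle) (E : sheaf).
Variables (EK : tensor_product E K) (EKmS : tensor_product EK (sheaf_of_poles S m)).

(* e (x) w as a section of E (x) K_X (x) O_X(mS), by O_X -> O_X(mS) *)
Definition simple_tensor (U : opens) (e : E U) (w : K U) : EKmS U :=
  tens EKmS U (tens EK U e w) (poles1 S m U).

(* connZ is k-linearity: regcst U c is the constant function c *)
Record singular_connection : Type := SingularConnection {
  conn :> forall U : opens, E U -> EKmS U;
  connD : forall (U : opens) (s t : E U), conn (s + t) = conn s + conn t;
  connZ : forall (U : opens) (c : k) (s : E U),
    conn (regcst U c *: s) = regcst U c *: conn s;
  conn_res : forall (U V : opens) (VU : V `<=` U) s,
    conn (res VU s) = res VU (conn s);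
  conn_leibniz : forall (U : opens) (f : regfun U) (s : E U),
    conn (f *: s) = f *: conn s + simple_tensor s (diff K U f)
}.

(* w is a section of F (x) K_X, seen as a subsheaf of E (x) K_X (x) O_X(mS),
   i.e. of the image sheaf of F (x) K_X *)
Definition in_tensor_cotangent (F : subsheaf E) (U : opens) (w : EKmS U) : Prop :=
  locally (fun V (VU : V `<=` U) =>
    exists (r : nat) (e : 'I_r -> E V) (a : 'I_r -> K V),
      (forall i, F V (e i)) /\ res VU w = \sum_i simple_tensor (e i) (a i)).

Definition induces_connection (D : singular_connection) (F : subsheaf E) : Prop :=
  forall (U : opens) (s : E U), F U s -> in_tensor_cotangent F (D U s).

End Connections.
End Sheaves.

(* Main.v *)
Require Import Defs.
From mathcomp Require Import all_boot all_order all_algebra.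
From mathcomp Require Import boolp classical_sets functions cardinality.
From mathcomp Require Import mpoly.

Set Implicit Arguments.
Unset Strict Implicit.
Unset Printing Implicit Defensive.
Import GRing.Theory.
Local Open Scope classical_set_scope.
Local Open Scope ring_scope.

(** The maximal subsheaf is the sum of all coherent subsheaves on which [D]
induces a connection.  A local section of this sum is a finite sum of sections
of such subsheaves and [D] is additive, so [D] induces a connection on the sum
([sum_induces_connection]); the sum contains all the others, so everything
rests on its being coherent.

A subsheaf [F] of a vector bundle need not be of finite type; what has to be
excluded is an [F] such as the extension by zero of the restriction to an open
set, which has too few sections near the points of the complement.  The
property that excludes it is [generically_generated]: near any point [x] there
are sections of [F] of which a given section of [F], possibly defined far from
[x], is a combination on some nonempty open set.  A subsheaf of finite type has this property, because
any two nonempty open sets meet ([finite_type_generically_generated]), and the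
property passes to arbitrary sums ([sum_generically_generated]).

Conversely a generically generated subsheaf is coherent
([generically_generated_coherent]).  Its sections, and also the relations
between given sections, are described by row vectors of regular functions, so
that one statement about such modules [M] of rows gives both halves of
coherence ([row_submodule_finite_type]).  It has three ingredients.
- Over some nonempty open set, [M] is generated by finitely many of its sections
  ([generic_generators]): choose sections whose values at one point are
  independent and as many as possible, and use Cramer's rule near this point.
- The stalk of [M] at a point [x] is finitely generated
  ([stalk_finitely_generated]), because the local ring is a ring of fractions
  of a quotient of a polynomial ring, which is noetherian.
- The topology of [X] is cofinite ([opens_of_supset]), because [X] has
  dimension one and its topology is noetherian.
By the generic generation, the generic generators can be replaced by sections
defined near [x].  Together with the generators of the stalk they generate [M]
at the points of a nonempty open set and at [x], hence on a neighbourhood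
of [x]. *)

(** * Noetherian modules and the Hilbert basis theorem *)

Section Fcat.
Variables (T : Type) (m n : nat) (f : 'I_m -> T) (g : 'I_n -> T).

Definition fcat (i : 'I_(m + n)) : T :=
  match fintype.split i with inl a => f a | inr b => g b end.

Lemma fcatl i : fcat (lshift n i) = f i.
Proof. by rewrite /fcat -[lshift n i]/(unsplit (inl i)) unsplitK. Qed.

Lemma fcatr i : fcat (rshift m i) = g i.
Proof. by rewrite /fcat -[rshift m i]/(unsplit (inr i)) unsplitK. Qed.

Lemma fcatP (P : T -> Prop) :
  (forall i, P (f i)) -> (forall i, P (g i)) -> forall i, P (fcat i).
Proof. by rewrite /fcat => Pf Pg i; case: fintype.split. Qed.

End Fcat.

Section Noetherian.

Definition submodule (R : nzRingType) (M : lmodType R) (N : set M) : Prop :=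
  N 0 /\ forall a x y, N x -> N y -> N (a *: x + y).

Definition noetherian (R : nzRingType) (M : lmodType R) : Prop :=
  forall N : set M, submodule N -> exists (q : nat) (g : 'I_q -> M),
    (forall i, N (g i)) /\
    forall x, N x -> exists c : 'I_q -> R, x = \sum_i c i *: g i.

Section Submodule.
Variables (R : nzRingType) (M : lmodType R) (N : set M).
Hypothesis subN : submodule N.

Lemma submoduleD x y : N x -> N y -> N (x + y).
Proof. by case: subN => _ NL Nx Ny; rewrite -[x]scale1r; apply: NL. Qed.

Lemma submoduleZ a x : N x -> N (a *: x).
Proof. by case: subN => N0 NL Nx; rewrite -[_ *: _]addr0; apply: NL. Qed.

Lemma submodule_sum (I : Type) (r : seq I) (P : pred I) (F : I -> M) :
  (forall i, P i -> N (F i)) -> N (\sum_(i <- r | P i) F i).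
Proof.
by move=> NF; elim/big_ind: _ => //; [case: subN | exact: submoduleD].
Qed.

Lemma submoduleB x y : N x -> N y -> N (x - y).
Proof. by case: subN => _ NL Nx Ny; rewrite -scaleN1r addrC; apply: NL. Qed.

End Submodule.

(** Generators of the image of [N] under [g], lifted to [N], together with
generators of the part of [N] that comes from [M1], generate [N]. *)
Lemma noetherian_extension (R : nzRingType) (M1 M M2 : lmodType R)
    (f : {linear M1 -> M}) (g : {linear M -> M2}) :
  (forall x, g x = 0 -> exists y, x = f y) ->
  noetherian M1 -> noetherian M2 -> noetherian M.
Proof.
move=> kerg noeth1 noeth2 N subN.
have [|q1 [g1 [Ng1 gen1]]] := noeth1 (f @^-1` N).
  split=> [|a x y /= Nx Ny]; first by rewrite /= linear0; case: subN.
  by rewrite /= linearP; case: subN => _; apply.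
have [|q2 [g2 [Ng2 gen2]]] := noeth2 (g @` N).
  split=> [|a _ _ [x Nx <-] [y Ny <-]].
    by exists 0; [case: subN | rewrite linear0].
  by exists (a *: x + y); [case: subN => _; apply | rewrite linearP].
have /choice[h hP] : forall i, exists x, N x /\ g x = g2 i.
  by move=> i; have [x Nx <-] := Ng2 i; exists x.
exists (q1 + q2)%N, (fcat (f \o g1) h); split.
  by apply: fcatP => // i; case: (hP i).
move=> x Nx; have [c2 c2E] := gen2 (g x) (imageP g Nx).
set y := x - \sum_i c2 i *: h i.
have Ny : N y.
  apply: submoduleB => //; apply: submodule_sum => // i _.
  by apply: submoduleZ => //; case: (hP i).
have gy : g y = 0.
  rewrite linearB linear_sum c2E /= -sumrB big1 // => i _.
  by rewrite linearZ /=; case: (hP i) => _ ->; rewrite subrr.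
have [z yz] := kerg _ gy.
have [c1 zE] : exists c1 : 'I_q1 -> R, z = \sum_i c1 i *: g1 i.
  by apply: gen1; rewrite /= -yz.
exists (fcat c1 c2); rewrite big_split_ord /=.
under eq_bigr do rewrite !fcatl.
under [X in _ + X]eq_bigr do rewrite !fcatr.
rewrite -[LHS](subrK (\sum_i c2 i *: h i)) -/y yz zE linear_sum.
by congr (_ + _); apply: eq_bigr => i _; rewrite linearZ.
Qed.

Lemma noetherian_rV (R : nzRingType) r : noetherian R^o -> noetherian 'rV[R]_r.
Proof.
move=> noethR; elim: r => [|r IH].
  move=> N subN; exists 0%N, (fun=> 0); split=> [[]//|x _].
  by exists (fun=> 0); rewrite big_ord0 [x]thinmx0.
apply: (@noetherian_extension _ 'rV[R]_r 'rV[R]_(1 + r) 'rV[R]_1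
  (mulmxr (row_mx 0 1%:M)) lsubmx) IH _ => [x x0|].
  exists (rsubmx x); rewrite /= mul_mx_row mulmx0 mulmx1.
  by rewrite -[LHS]hsubmxK x0.
move=> N subN; have [|q [g [Ng gen]]] := noethR ((fun a => a%:M) @^-1` N).
  split=> [|a x y /= Nx Ny]; first by rewrite /= raddf0; case: subN.
  by rewrite /= raddfD /= -scale_scalar_mx; case: subN => _; apply.
exists q, (fun i => (g i)%:M); split=> // x Nx.
have [c cE] : exists c : 'I_q -> R, x 0 0 = \sum_i c i * g i.
  by apply: gen; rewrite /= -mx11_scalar.
exists c; rewrite [LHS]mx11_scalar cE raddf_sum /=.
by apply: eq_bigr => i _; rewrite scale_scalar_mx.
Qed.

(** Hilbert's basis theorem.  Above the degree [D] by which all leading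
coefficients have appeared, an element of [I] can be reduced in degree; the
elements of degree less than [D] form a submodule of a free [R]-module of
rank [D]. *)
Lemma noetherian_poly (R : comNzRingType) :
  noetherian R^o -> noetherian {poly R}^o.
Proof.
move=> noethR I subI.
have IM (a p : {poly R}) : I p -> I (a * p) by exact: (submoduleZ subI).
have IZ (a : R) (p : {poly R}) : I p -> I (a *: p).
  by rewrite -mul_polyC; exact: IM.
(* [d] only bounds the degree of [p], so that [L] contains 0 and is stable
   under addition *)
pose L : set R^o := [set a | exists d, exists2 p : {poly R}, I p &
  (size p <= d.+1)%N /\ p`_d = a].
have shift d e (p : {poly R}) : I p -> (size p <= d.+1)%N -> (d <= e)%N ->
    exists2 p' : {poly R}, I p' & (size p' <= e.+1)%N /\ p'`_e = p`_d.
  move=> Ip sp de; exists ('X^(e - d) * p); first exact: IM.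
  split; last by rewrite coefXnM ltnNge leq_subr /= subKn.
  have [->|p0] := eqVneq p 0; first by rewrite mulr0 size_poly0.
  by rewrite mulrC size_mulXn // -(subnK de) -addnS (subnK de) leq_add2l.
have [|q [a [La genL]]] := noethR L.
  split=> [|c _ _ [d1 [p1 I1 [s1 <-]]] [d2 [p2 I2 [s2 <-]]]].
    by exists 0%N, 0; [case: subI | rewrite size_poly0 coef0].
  have [p1' I1' [s1' <-]] := shift _ (d1 + d2)%N _ I1 s1 (leq_addr _ _).
  have [p2' I2' [s2' <-]] := shift _ (d1 + d2)%N _ I2 s2 (leq_addl _ _).
  exists (d1 + d2)%N, (c *: p1' + p2').
    by apply: (submoduleD subI) => //; apply: IZ.
  split; last by rewrite coefD coefZ.
  rewrite (leq_trans (size_polyD _ _)) // geq_max s2' andbT.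
  exact: leq_trans (size_scale_leq _ _) _.
have /choice[d /choice[f fP]] : forall i, exists e, exists p : {poly R},
    I p /\ ((size p <= e.+1)%N /\ p`_e = a i).
  by move=> i; have [e [p Ip pP]] := La i; exists e, p.
pose D := \max_i d i.
have /choice[h hP] : forall i, exists p' : {poly R},
    I p' /\ ((size p' <= D.+1)%N /\ p'`_D = a i).
  move=> i; have [If [sf fa]] := fP i.
  have [p' Ip' [sp' pa]] := shift _ D _ If sf (leq_bigmax i).
  by exists p'; rewrite pa fa.
have [|s [g [Ig genI]]] := @noetherian_rV R D noethR (rVpoly @^-1` I).
  split=> [|c x y /= Ix Iy]; first by rewrite /= raddf0; case: subI.
  by rewrite /= linearP; apply: (submoduleD subI) => //; apply: IZ.
exists (q + s)%N, (fcat h (rVpoly \o g)); split.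
  by apply: fcatP => // i; case: (hP i).
suff H m (p : {poly R}) : (size p <= m)%N -> I p ->
    exists (b : 'I_q -> {poly R}) (c : 'I_s -> {poly R}),
    p = \sum_i b i * h i + \sum_i c i * rVpoly (g i).
  move=> p Ip; have [b [c ->]] := H _ _ (leqnn _) Ip.
  exists (fcat b c); rewrite big_split_ord /=.
  by congr (_ + _); apply: eq_bigr => i _; rewrite !(fcatl, fcatr).
elim: m p => [|m IH] p sp Ip.
  exists (fun=> 0), (fun=> 0); rewrite !big1 ?addr0; try by move=> *; rewrite mul0r.
  by apply/eqP; rewrite -size_poly_leq0.
have [mD|Dm] := ltnP m D.
  have [|c cE] := genI (poly_rV p); first by rewrite /= poly_rV_K ?(leq_trans sp).
  exists (fun=> 0), (fun i => (c i)%:P).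
  rewrite big1 ?add0r; last by move=> *; rewrite mul0r.
  rewrite -[LHS](@poly_rV_K _ D) ?(leq_trans sp) // cE linear_sum /=.
  by apply: eq_bigr => i _; rewrite linearZ /= mul_polyC.
have [|c cE] := genL p`_m; first by exists m, p.
have [||b [e]] := IH (p - \sum_i (c i *: 'X^(m - D)) * h i).
- apply/leq_sizeP => j mj; rewrite coefB coef_sum.
  have coefE i : (c i *: 'X^(m - D) * h i)`_j = c i * (h i)`_(j - (m - D)).
    rewrite -scalerAl coefZ coefXnM ltnNge (leq_trans _ mj) //.
    exact: leq_subr.
  under eq_bigr do rewrite coefE.
  move: mj; rewrite leq_eqVlt => /predU1P[<-|mj].
    rewrite subKn // cE -sumrB big1 // => i _.
    by have [_ [_ ->]] := hP i; rewrite subrr.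
  rewrite nth_default ?(leq_trans sp) // big1 ?subr0 // => i _.
  have [_ [sh _]] := hP i; rewrite nth_default ?mulr0 // (leq_trans sh) //.
  by rewrite -[D in (D < _)%N](subKn Dm) ltn_sub2r // (leq_ltn_trans (leq_subr _ _)).
- apply: (submoduleB subI) => //; apply: (submodule_sum subI) => i _.
  by apply: IM; case: (hP i).
move=> E; exists (fun i => b i + c i *: 'X^(m - D)), e.
rewrite -[LHS](subrK (\sum_i (c i *: 'X^(m - D)) * h i)) E addrAC -big_split /=.
by congr (_ + _); apply: eq_bigr => i _; rewrite mulrDl.
Qed.

Lemma noetherian_surj (R S : nzRingType) (f : {rmorphism R -> S}) :
  (forall y, exists x, f x = y) -> noetherian R^o -> noetherian S^o.
Proof.
move=> surj noethR I subI.
have [|q [g [Ig gen]]] := noethR (f @^-1` I).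
  split=> [|a x y /= Ix Iy]; first by rewrite /= rmorph0; case: subI.
  by rewrite /= rmorphD rmorphM; case: subI => _; apply.
exists q, (f \o g); split=> // y; have [x <- Ix] := surj y.
have [c ->] := gen _ Ix; exists (f \o c).
by rewrite rmorph_sum; apply: eq_bigr => i _; rewrite rmorphM.
Qed.

Lemma noetherian_field (F : fieldType) : noetherian F^o.
Proof.
move=> I subI; have [[a Ia a0]|I0] := pselect (exists2 a, I a & a != 0).
  exists 1%N, (fun=> a); split=> // x _; exists (fun=> x / a).
  by rewrite big_ord1 /= [RHS]mulfVK.
exists 0%N, (fun=> 0); split=> [[]//|x Ix]; exists (fun=> 0).
rewrite big_ord0; apply: contrapT => /eqP x0; apply: I0; by exists x.
Qed.

(** The polynomials in [n.+1] variables are the values, at the last variable,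
of the univariate polynomials over those in [n] variables. *)
Lemma noetherian_mpoly (F : fieldType) n : noetherian {mpoly F[n]}^o.
Proof.
elim: n => [|n /noetherian_poly IH].
  apply: (noetherian_surj (f := @mpolyC 0 F)) (@noetherian_field F) => p.
  exists p@_0; apply/mpolyP => m; rewrite mcoeffC.
  have -> : m = 0%MM by apply/mnmP => -[].
  by rewrite eqxx mulr1.
pose f : {rmorphism {poly {mpoly F[n]}} -> {mpoly F[n.+1]}} :=
  horner_eval 'X_ord_max \o map_poly (@mwiden n F).
apply: (noetherian_surj (f := f)) IH.
have fC c : f c%:P = mwiden c by rewrite /f /= map_polyC /= /horner_eval hornerC.
have fX : f 'X = 'X_ord_max by rewrite /f /= map_polyX /horner_eval hornerX.
have surjM x y : (exists p, f p = x) -> (exists p, f p = y) -> exists p, f p = x * y.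
  by move=> [p <-] [r <-]; exists (p * r); rewrite rmorphM.
have surj1 : exists p, f p = 1 by exists 1; rewrite rmorph1.
move=> p; elim/mpolyind: p => [|c m p _ _ [r <-]]; first by exists 0; rewrite rmorph0.
suff [t <-] : exists t, f t = 'X_[m].
  by exists ((c%:MP)%:P * t + r); rewrite rmorphD rmorphM fC /= mwidenC mul_mpolyC.
rewrite mpolyXE_id.
elim/big_ind: _ => // i _; elim: (m i) => [|e IHe]; first by rewrite expr0.
rewrite exprS; apply: surjM => //.
have [j ->|->] := unliftP ord_max i; last by exists 'X.
exists ('X_j)%:P; rewrite fC mwidenX mnmwiden1; congr 'X_[U_(_)].
by apply: val_inj; rewrite /= /bump leqNgt ltn_ord.
Qed.

End Noetherian.

(** * The topology of a projective curve *)

Section Topology.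
Variables (k : closedFieldType) (n : nat).
Implicit Types (Z A B : set (proj k n)) (p : {mpoly k[n.+1]}).

Lemma zclosed0 : zclosed (set0 : set (proj k n)).
Proof. by have := @zopenT k n; rewrite /zopen setCT. Qed.

Lemma zclosedI A B : zclosed A -> zclosed B -> zclosed (A `&` B).
Proof.
move=> [P1 [h1 ->]] [P2 [h2 ->]]; exists (P1 `|` P2); split.
  by move=> p [/h1|/h2].
apply/seteqP; split=> x; first by move=> [H1 H2] p [/H1|/H2].
by move=> H; split=> p Pp; apply: H; [left|right].
Qed.

Lemma zopen_nonzero d p : p \is d.-homog -> zopen [set x | peval p x != 0].
Proof.
move=> hp; exists [set p]; split; first by move=> _ ->; exists d.
apply/seteqP; split=> x /=; last by move/(_ p erefl) ->; rewrite eqxx.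
by move=> /negP/negPn/eqP px _ ->.
Qed.

(** The normalized representative of a point is determined by the minors
[v_i u_j - v_j u_i]: these say that [u] is a multiple of [v], and both have 1
as their first nonzero coordinate. *)
Lemma zclosed1 (x : proj k n) : zclosed [set x].
Proof.
pose p i j : {mpoly k[n.+1]} := sval x 0 i *: 'X_j - sval x 0 j *: 'X_i.
exists [set q | exists i j, q = p i j]; split.
  move=> _ [i [j ->]]; exists 1%N.
  by apply: rpredB; apply: dhomogZ; rewrite dhomogX /= mdeg1.
apply/seteqP; split=> y /=.
  move=> -> _ [i [j ->]].
  by rewrite /peval mevalB !mevalZ !mevalXU mulrC subrr.
move=> H; case: x y @p H => v nv [u nu] p H.
have /existsP[a /andP[/eqP va /forallP/= v0]] := nv.
have E i j : v 0 i * u 0 j = v 0 j * u 0 i.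
  apply/eqP; rewrite -subr_eq0; apply/eqP.
  have := H _ (ex_intro _ i (ex_intro _ j erefl)).
  by rewrite /peval mevalB !mevalZ !mevalXU.
have {}E j : u 0 j = v 0 j * u 0 a by rewrite -E va mul1r.
apply: val_inj; apply/rowP => j /=; rewrite E.
have /existsP[b /andP[/eqP ub /forallP/= u0]] := nu.
have [ab|ba|ab] := ltngtP a b.
- by move/eqP: ub; rewrite E (eqP (implyP (u0 a) ab)) mulr0 eq_sym oner_eq0.
- by move/eqP: ub; rewrite E (eqP (implyP (v0 b) ba)) mul0r eq_sym oner_eq0.
- by rewrite (ord_inj ab) ub mulr1.
Qed.

Lemma finite_zclosed A : finite_set A -> zclosed A.
Proof.
move=> /finite_seqP[s ->]; elim: s => [|x s IH].
  rewrite (_ : [set` _] = set0); first exact: zclosed0.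
  by apply/seteqP; split.
rewrite (_ : [set` _] = [set x] `|` [set` s]).
  by apply: zclosedU IH; exact: zclosed1.
apply/seteqP; split=> y /=; rewrite inE.
  by move=> /orP[/eqP ->|]; [left|right].
by move=> [->|ys]; rewrite ?eqxx ?ys ?orbT.
Qed.

(** The polynomials vanishing on some [Z i] form an ideal, and its finitely many
generators all vanish on a common [Z i]. *)
Lemma zclosed_noetherian (Z : nat -> set (proj k n)) :
  (forall i, zclosed (Z i)) -> (forall i, Z i.+1 `<=` Z i) ->
  exists i, Z i `<=` Z i.+1.
Proof.
move=> cZ dZ.
have leZ i j : (i <= j)%N -> Z j `<=` Z i.
  by move=> /subnK <-; elim: (j - i)%N => // e IH x /dZ; exact: IH.
pose I : set {mpoly k[n.+1]}^o := [set p | exists i, forall x, Z i x -> peval p x = 0].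
have [|q [g [Ig gen]]] := @noetherian_mpoly k n.+1 I.
  split=> [|a p r [i pi] [j rj]]; first by exists 0%N => x _; exact: meval0.
  exists (maxn i j) => x Zx; rewrite /peval mevalD mevalM.
  rewrite -!/(peval _ _) pi ?rj ?mulr0 ?addr0 //.
    exact: leZ (leq_maxr i j) _ Zx.
  exact: leZ (leq_maxl i j) _ Zx.
have /choice[f fP] : forall a, exists i, forall x, Z i x -> peval (g a) x = 0 by [].
exists (\max_a f a) => x Zx; set N := \max_a f a in Zx.
have [P [_ ZE]] := cZ N.+1; rewrite ZE => p Pp.
have [|c ->] := gen p; first by exists N.+1 => y; rewrite ZE; apply.
rewrite /peval raddf_sum big1 // => a _ /=; rewrite mevalM.
rewrite -!/(peval _ _) (fP a) ?mulr0 //; exact: leZ (leq_bigmax a) _ Zx.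
Qed.

(** Otherwise dependent choice gives a strictly decreasing sequence of closed
sets. *)
Lemma zclosed_minimal (C : set (set (proj k n))) Z0 :
  C `<=` @zclosed k n -> C Z0 ->
  exists Z, [/\ C Z, Z `<=` Z0 & forall Y, C Y -> Y `<=` Z -> Z `<=` Y].
Proof.
move=> Ccl CZ0; apply: contrapT => nomin.
have step (A : {A | C A /\ A `<=` Z0}) : exists B : {A | C A /\ A `<=` Z0},
    sval B `<=` sval A /\ ~ sval A `<=` sval B.
  case: A => A /= [CA AZ0]; apply: contrapT => noB; apply: nomin.
  exists A; split=> // Y CY YA; apply: contrapT => nAY; apply: noB.
  by exists (exist _ Y (conj CY (subset_trans YA AZ0))).
have [f fP] := choice step.
pose Z i := iter i f (exist _ Z0 (conj CZ0 (@subset_refl _ Z0))).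
have [i||i iP] := @zclosed_noetherian (fun i => sval (Z i)).
- by apply: Ccl; case: (Z i) => /= ? [].
- by move=> i; have [] := fP (Z i).
- by have [_ /(_ iP)] := fP (Z i).
Qed.

End Topology.

Section Curve.
Variables (k : closedFieldType) (n : nat) (X : smooth_projective_curve k n).

(** A minimal infinite closed subset [Y] of [Z] is irreducible, since one of two
closed sets covering it meets it in an infinite set.  Then a point of [Y], [Y]
and [X] form a chain of length two, which the dimension forbids. *)
Lemma proper_closed_finite (Z : set (proj k n)) :
  zclosed Z -> Z `<=` X -> ~ X `<=` Z -> finite_set Z.
Proof.
move=> cZ ZX nXZ; apply: contrapT => infZ.
have [||Y [[cY infY] YZ Ymin]] :=
  @zclosed_minimal k n [set A | zclosed A /\ infinite_set A] Z; [by move=> A /= []|by []|].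
have Y0 : Y !=set0 by apply: infinite_setN0.
have irrY : irreducible Y.
  split=> // A B cA cB YAB; apply: contrapT => /not_orP[nA nB].
  have fin C : zclosed C -> ~ Y `<=` C -> finite_set (Y `&` C).
    move=> cC nC; apply: contrapT => infC; apply: nC.
    have YC : Y `<=` Y `&` C.
      by apply: Ymin; [split=> //; exact: zclosedI | exact: subIsetl].
    by move=> y /YC[].
  apply: infY; rewrite (_ : Y = (Y `&` A) `|` (Y `&` B)).
    by rewrite finite_setU; split; apply: fin.
  by rewrite -setIUr; apply/esym/setIidPl.
have [y Yy] := Y0.
have irry : irreducible [set y].
  split; first by exists y.
  by move=> A B _ _ /(_ y erefl)[]; [left|right] => _ ->.
case: (curve_dimension X) => _; apply.
exists (fun i => if i is j.+1 then if j is _.+1 then X : set _ else Y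
  else [set y]); split.
  move=> [|[|i]] _; split=> //.
  - exact: zclosed1.
  - by move=> _ ->; apply/ZX/YZ.
  - exact: subset_trans YZ ZX.
  - exact: curve_closed.
  - exact: curve_irreducible.
move=> [|[|//]] _; split.
- by move=> _ ->.
- by move=> Yy1; apply: infY; apply: sub_finite_set Yy1 _.
- exact: subset_trans YZ ZX.
- by move=> XY; apply: nXZ; exact: subset_trans XY YZ.
Qed.

Implicit Types U V W : opens X.

Lemma opens_sub U : U `<=` X.
Proof. by have [Z _ ->] := opensP U; exact: subDsetl. Qed.

Lemma opens_of_zopen (A : set (proj k n)) : zopen A ->
  exists U : opens X, U = X `&` A :> set _.
Proof.
move=> oA; have UP : exists2 Z, zclosed Z & X `&` A = X `\` Z.
  by exists (~` A) => //; rewrite setDE setCK.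
by exists (Opens UP).
Qed.

Lemma opensI_neq0 U V : U !=set0 -> V !=set0 -> opensI U V !=set0.
Proof.
move=> [x Ux] [y Vy]; apply: contrapT => UV0.
have [Z1 cZ1 UE] := opensP U; have [Z2 cZ2 VE] := opensP V.
have XZ : X `<=` Z1 `|` Z2.
  move=> z Xz; apply: contrapT => /not_orP[nZ1 nZ2]; apply: UV0.
  by exists z; rewrite /= UE VE.
have [_ /(_ _ _ cZ1 cZ2 XZ)[XZ1|XZ2]] := curve_irreducible X.
  by move: Ux; rewrite UE => -[/XZ1].
by move: Vy; rewrite VE => -[/XZ2].
Qed.

(** The complement of a nonempty open subset of [X] is finite, hence so is the
complement of any larger set. *)
Lemma opens_of_supset V (A : set (proj k n)) :
  V !=set0 -> V `<=` A -> A `<=` X -> exists U : opens X, U = A :> set _.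
Proof.
move=> [x Vx] VA AX.
have UP : exists2 Z, zclosed Z & A = X `\` Z.
  exists (X `\` A); last by rewrite setDD; apply/esym/setIidPr.
  apply: finite_zclosed; have [Z cZ VE] := opensP V.
  apply: (@sub_finite_set _ _ (X `&` Z)).
    move=> y [Xy nAy]; split=> //; apply: contrapT => nZy; apply/nAy/VA.
    by rewrite VE.
  apply: proper_closed_finite => [||/(_ x (opens_sub Vx))[_]].
  - by apply: zclosedI => //; exact: curve_closed.
  - exact: subIsetl.
  - by move: Vx; rewrite VE => -[].
by exists (Opens UP).
Qed.

End Curve.

(** * Regular functions as fractions of forms *)

Section RegularTotal.
Variables (k : closedFieldType) (n : nat).
Implicit Types (A B : set (proj k n)) (f g : proj k n -> k).

(** Functions on the whole projective space stand for functions on a subset: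
their values at a point can then be assembled into matrices without any
transport between subset types. *)
Definition regular_on A f : Prop := @regular k n A (fun y => f (val y)).

Lemma regular_on_ext A f g : (forall y, A y -> f y = g y) ->
  regular_on A f -> regular_on A g.
Proof.
move=> fg; rewrite /regular_on.
rewrite (_ : (fun y : A => f (val y)) = (fun y => g (val y))) //.
by apply: funext => y; apply: fg; exact: set_valP.
Qed.

Lemma regular_on_sub A B f : A `<=` B -> regular_on B f -> regular_on A f.
Proof. by move=> AB; exact: (@regular_sub _ _ _ _ AB). Qed.

Lemma regular_on_cst A (c : k) : regular_on A (fun=> c).
Proof. exact: regular_cst. Qed.

Lemma regular_onB A f g : regular_on A f -> regular_on A g ->
  regular_on A (fun y => f y - g y).
Proof. by move=> rf rg; exact: regularB. Qed.

Lemma regular_onD A f g : regular_on A f -> regular_on A g ->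
  regular_on A (fun y => f y + g y).
Proof.
move=> rf rg; have := regular_onB rf (regular_onB (regular_on_cst (A := A) 0) rg).
by apply: regular_on_ext => y _; rewrite sub0r opprK.
Qed.

Lemma regular_onM A f g : regular_on A f -> regular_on A g ->
  regular_on A (fun y => f y * g y).
Proof. by move=> rf rg; exact: regularM. Qed.

Lemma regular_on_sum A (I : Type) (r : seq I) (P : pred I) (F : I -> proj k n -> k) :
  (forall i, P i -> regular_on A (F i)) ->
  regular_on A (fun y => \sum_(i <- r | P i) F i y).
Proof.
move=> rF; elim: r => [|i r IH].
  by apply: regular_on_ext (regular_on_cst (A := A) 0) => y _; rewrite big_nil.
have [Pi|nPi] := boolP (P i).
  by apply: regular_on_ext (regular_onD (rF i Pi) IH) => y _; rewrite big_cons Pi.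
by apply: regular_on_ext IH => y _; rewrite big_cons (negPf nPi).
Qed.

Lemma regular_on_prod A (I : Type) (r : seq I) (P : pred I) (F : I -> proj k n -> k) :
  (forall i, P i -> regular_on A (F i)) ->
  regular_on A (fun y => \prod_(i <- r | P i) F i y).
Proof.
move=> rF; elim: r => [|i r IH].
  by apply: regular_on_ext (regular_on_cst (A := A) 1) => y _; rewrite big_nil.
have [Pi|nPi] := boolP (P i).
  by apply: regular_on_ext (regular_onM (rF i Pi) IH) => y _; rewrite big_cons Pi.
by apply: regular_on_ext IH => y _; rewrite big_cons (negPf nPi).
Qed.

Lemma regular_on_det A m (F : proj k n -> 'M[k]_m) :
  (forall i j, regular_on A (fun y => F y i j)) ->
  regular_on A (fun y => \det (F y)).
Proof.
move=> rF; apply: regular_on_sum => s _; apply: regular_onM.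
  exact: regular_on_cst.
by apply: regular_on_prod => i _; exact: rF.
Qed.

Lemma regular_onV A f : regular_on A f -> (forall y, A y -> f y != 0) ->
  regular_on A (fun y => (f y)^-1).
Proof.
move=> rf f0 x; have [W oW [Wx [d [p [q [hp hq H]]]]]] := rf x.
exists W => //; split=> //; exists d, q, p; split=> // y Wy.
have [q0 fE] := H y Wy; have := f0 _ (set_valP y); rewrite fE.
by rewrite mulf_eq0 invr_eq0 negb_or => /andP[-> _]; rewrite invf_div.
Qed.

(** Dehomogenization with respect to the coordinate [j].  It turns every
polynomial, homogeneous or not, into a regular function on the affine chart
where the coordinate [j] does not vanish. *)
Definition affeval (j : 'I_n.+1) (p : {mpoly k[n.+1]}) (y : proj k n) : k :=
  p.@[fun i => sval y 0 i / sval y 0 j].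

Lemma affeval_dhomog j d p (y : proj k n) : p \is d.-homog -> sval y 0 j != 0 ->
  peval p y = affeval j p y * sval y 0 j ^+ d.
Proof.
move=> /dhomogP hp yj; rewrite /peval /affeval !mevalE mulr_suml.
rewrite !big_seq; apply: eq_bigr => m /hp <- /=; rewrite -mulrA; congr (_ * _).
rewrite mdegE -prodrXr -big_split /=; apply: eq_bigr => i _.
by rewrite -exprMn divfK.
Qed.

Lemma regular_on_affeval A j p : (forall y, A y -> sval y 0 j != 0) ->
  regular_on A (affeval j p).
Proof.
move=> Aj; rewrite /affeval.
have rX i : regular_on A (fun y => sval y 0 i / sval y 0 j).
  move=> x; exists setT; first exact: zopenT.
  split=> //; exists 1%N, 'X_i, 'X_j; split; [by rewrite dhomogX /= mdeg1..|].
  by move=> y _; rewrite /peval !mevalXU; split=> //; apply: Aj; exact: set_valP.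
apply: (@regular_on_ext _ (fun y => \sum_(m <- msupp p) p@_m *
  \prod_i \prod_(e < m i) (sval y 0 i / sval y 0 j))).
  move=> y _; rewrite mevalE; apply: eq_bigr => m _; congr (_ * _).
  by apply: eq_bigr => i _; rewrite prodr_const card_ord.
apply: regular_on_sum => m _; apply: regular_onM; first exact: regular_on_cst.
by apply: regular_on_prod => i _; apply: regular_on_prod => e _; exact: rX.
Qed.

Lemma coord_neq0 (y : proj k n) : exists j, sval y 0 j != 0.
Proof.
by case: y => v /= /existsP[i /andP[/eqP vi _]]; exists i; rewrite vi oner_neq0.
Qed.

End RegularTotal.

Section Fractions.
Variables (k : closedFieldType) (n : nat) (X : smooth_projective_curve k n).
Implicit Types (U V W : opens X) (f : proj k n -> k).

(** The zeros of [p] and the complement of [V] are closed sets that cover the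
irreducible [X], and the second is not all of [X]. *)
Lemma dhomog_identity V d (p : {mpoly k[n.+1]}) : p \is d.-homog -> V !=set0 ->
  (forall y, V y -> peval p y = 0) -> forall y, X y -> peval p y = 0.
Proof.
move=> hp V0 pV y Xy; apply: contrapT => /eqP py.
have [W WE] := opens_of_zopen X (zopen_nonzero hp).
have [|z [Vz]] := opensI_neq0 V0 (_ : W !=set0); first by exists y; rewrite WE.
by rewrite WE => -[_ /=]; rewrite pV // eqxx.
Qed.

(** Two local expressions of [f] as a fraction agree on a nonempty open set, so
the identity obtained by clearing denominators holds on all of [X].  This is
why a fraction found near [y] is valid on the whole domain of [f]. *)
Lemma regular_quotient V f y : regular_on V f -> V y ->
  exists d p q, [/\ p \is d.-homog, q \is d.-homog, peval q y != 0 &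
    forall z, V z -> peval q z * f z = peval p z].
Proof.
move=> rf Vy; have [W oW /= [Wy [d [p [q [hp hq H]]]]]] := rf (SigSub (mem_set Vy)).
have [U UE] := opens_of_zopen X oW.
have HW z : V z -> W z -> peval q z != 0 /\ f z = peval p z / peval q z.
  by move=> Vz Wz; exact: (H (SigSub (mem_set Vz))).
exists d, p, q; split=> //; first by have [] := HW y Vy Wy.
move=> z Vz; have [W' oW' /= [W'z [d' [p' [q' [hp' hq' H']]]]]] := rf (SigSub (mem_set Vz)).
have [U' U'E] := opens_of_zopen X oW'.
have HW' t : V t -> W' t -> peval q' t != 0 /\ f t = peval p' t / peval q' t.
  by move=> Vt W't; exact: (H' (SigSub (mem_set Vt))).
have Xz := opens_sub Vz; have Xy := opens_sub Vy.
have hh : q * p' - q' * p \is (d + d').-homog.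
  by apply: rpredB; [|rewrite addnC]; exact: dhomogM.
have VUU' : opensI V (opensI U U') !=set0.
  apply: opensI_neq0; first by exists z.
  by apply: opensI_neq0; [exists y; rewrite UE | exists z; rewrite U'E].
have := @dhomog_identity _ _ _ hh VUU' _ z Xz.
rewrite /peval !mevalB !mevalM -!/(peval _ _) => E.
have [q'0 fz] := HW' z Vz W'z.
rewrite fz mulrA; apply: (canLR (mulfK q'0)); rewrite [RHS]mulrC.
apply/eqP; rewrite -subr_eq0; apply/eqP/E => t /= [Vt []].
rewrite UE U'E => -[_ Wt] [_ W't].
rewrite mevalB !mevalM -!/(peval _ _).
have [q0 ft] := HW t Vt Wt; have [q'0t ft'] := HW' t Vt W't.
have /eqP := etrans (esym ft) ft'; rewrite eqr_div // => /eqP.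
by rewrite mulrC => ->; rewrite mulrC subrr.
Qed.

Lemma regular_nonzero_near V f y : regular_on V f -> V y -> f y != 0 ->
  exists W : opens X, [/\ W y, W `<=` V & forall z, W z -> f z != 0].
Proof.
move=> rf Vy fy; have [d [p [q [hp hq qy E]]]] := regular_quotient rf Vy.
have [W WE] := opens_of_zopen X (zopen_nonzero hp).
exists (opensI V W); split.
- split=> //; rewrite WE /=; split; first exact: opens_sub Vy.
  by rewrite -E // mulf_neq0.
- exact: subIsetl.
- move=> z /= [Vz]; rewrite WE /= -E // => -[_].
  by rewrite mulf_eq0 negb_or => /andP[].
Qed.

Lemma opens_coord (j : 'I_n.+1) : exists W : opens X,
  W = X `&` [set y : proj k n | sval y 0 j != 0] :> set _.
Proof.
have hX : ('X_j : {mpoly k[n.+1]}) \is 1%N.-homog by rewrite dhomogX /= mdeg1.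
have [W WE] := opens_of_zopen X (zopen_nonzero hX).
by exists W; rewrite WE; congr (_ `&` _); apply/seteqP; split=> y; rewrite /peval /= mevalXU.
Qed.

(** The factor [affeval j q] is defined on the whole chart, also at the points
of the chart outside [V]: this is how functions that are regular only on [V]
are brought near an arbitrary point. *)
Lemma common_denominator V y j r (f : 'I_r -> proj k n -> k) :
  (forall i, regular_on V (f i)) -> V y -> sval y 0 j != 0 ->
  exists q p, affeval j q y != 0 /\
    forall i z, V z -> sval z 0 j != 0 ->
      affeval j q z * f i z = affeval j (p i) z.
Proof.
move=> rf Vy yj.
have /choice[q /choice[p qp]] : forall i, exists q p, affeval j q y != 0 /\
    forall z, V z -> sval z 0 j != 0 -> affeval j q z * f i z = affeval j p z.
  move=> i; have [d [p [q [hp hq qy E]]]] := regular_quotient (rf i) Vy.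
  exists q, p; split=> [|z Vz zj].
    by move: qy; rewrite (affeval_dhomog hq yj) mulf_eq0 negb_or => /andP[].
  have := E z Vz; rewrite (affeval_dhomog hq zj) (affeval_dhomog hp zj) mulrAC.
  by apply: mulIf; rewrite expf_neq0.
exists (\prod_i q i), (fun i => \prod_(l | l != i) q l * p i); split.
  rewrite /affeval rmorph_prod /=; apply/prodf_neq0 => i _.
  by case: (qp i).
move=> i z Vz zj; have [_ /(_ z Vz zj) E] := qp i.
rewrite (bigD1 i) //= /affeval !mevalM -!/(affeval _ _ _) -E.
by rewrite mulrAC mulrC.
Qed.

End Fractions.

(** * Modules of rows of regular functions *)

Section Core.
Variables (k : closedFieldType) (n : nat) (X : smooth_projective_curve k n).
Implicit Types (U V W : opens X).

Lemma opensIl U V : opensI U V `<=` U.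
Proof. exact: subIsetl. Qed.

Lemma opensIr U V : opensI U V `<=` V.
Proof. exact: subIsetr. Qed.

Lemma opens_bigI (C : opens X -> Prop) U N (V : 'I_N -> opens X) :
  C U -> (forall V W, C V -> C W -> C (opensI V W)) -> (forall i, C (V i)) ->
  exists W, [/\ C W, W `<=` U & forall i, W `<=` V i].
Proof.
move=> CU CI CV.
suff [W [CW WU WV]] : exists W,
    [/\ C W, W `<=` U & forall i, i \in enum 'I_N -> W `<=` V i].
  by exists W; split=> // i; apply: WV; rewrite mem_enum.
elim: (enum 'I_N) => [|i s [W [CW WU WV]]]; first by exists U; split.
exists (opensI W (V i)); split; first exact: CI.
- by move=> y /= [/WU].
- move=> l; rewrite inE => /predU1P[->|ls] y /= [Wy Viy] //; exact: WV Wy.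
Qed.

Lemma opens_bigI_point x U N (V : 'I_N -> opens X) :
  U x -> (forall i, V i x) -> exists W, [/\ W x, W `<=` U & forall i, W `<=` V i].
Proof. by move=> Ux Vx; apply: (opens_bigI (C := fun W => W x)) => // *; split. Qed.

Lemma opens_bigI_neq0 U N (V : 'I_N -> opens X) :
  U !=set0 -> (forall i, V i !=set0) ->
  exists W, [/\ W !=set0, W `<=` U & forall i, W `<=` V i].
Proof.
move=> U0 V0; apply: (opens_bigI (C := fun W => W !=set0)) => // *.
exact: opensI_neq0.
Qed.

Variables (U0 : opens X) (r : nat) (M : opens X -> set (proj k n -> 'rV[k]_r)).

(** A presheaf of submodules of the restriction to [U0] of the free module of
rank [r]; [rs_ext] says that only the values over the open set matter. *)
Record row_submodule : Prop := RowSubmodule {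
  rs_sub : forall V t, M V t -> V `<=` U0;
  rs_regular : forall V t, M V t -> forall i, regular_on V (fun y => t y 0 i);
  rs0 : forall V, V `<=` U0 -> M V (fun=> 0);
  rsD : forall V s t, M V s -> M V t -> M V (fun y => s y + t y);
  rsZ : forall V f t, regular_on V f -> M V t -> M V (fun y => f y *: t y);
  rs_res : forall V W t, W `<=` V -> M V t -> M W t;
  rs_ext : forall V s t, (forall y, V y -> s y = t y) -> M V s -> M V t
}.

(** Quasi-coherence, for submodules of a free module on a curve: every section
is, generically, a multiple of a section defined near any prescribed point. *)
Definition generically_extends : Prop := forall V t x, M V t -> V !=set0 -> U0 x ->
  exists W V' s c, [/\ W x, M W s, V' !=set0, V' `<=` W & V' `<=` V] /\
    (regular_on V' c /\ forall y, V' y -> t y = c y *: s y).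

Hypothesis rsM : row_submodule.

(** Take as many sections as possible with independent values at some point [y].
Near [y] the values of these sections stay independent, and by maximality they
span the value of every other section.  The coefficients are regular by
Cramer's rule. *)
Lemma generic_generators : U0 !=set0 ->
  exists V N (v : 'I_N -> proj k n -> 'rV[k]_r),
  [/\ V !=set0, V `<=` U0, forall i, M V (v i) &
    forall W t, W `<=` V -> M W t -> exists c : 'I_N -> proj k n -> k,
      (forall i, regular_on W (c i)) /\
      forall y, W y -> t y = \sum_i c i y *: v i y].
Proof.
move=> [y0 U0y0].
pose free N := exists V y (v : 'I_N -> proj k n -> 'rV[k]_r),
  [/\ V y, V `<=` U0, forall i, M V (v i) & row_free (\matrix_(i < N) v i y)].
have free_le N : `[< free N >] -> (N <= r)%N.
  by move=> /asboolP[V [y [v [_ _ _ /eqP <-]]]]; exact: rank_leq_col.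
have free0 : exists N, `[< free N >].
  exists 0%N; apply/asboolP; exists U0, y0, (fun=> fun=> 0); split=> // [[]//|].
  by rewrite /row_free -leqn0 rank_leq_row.
case: (ex_maxnP free0 free_le) => N /asboolP[V0 [y [v [V0y V0U Mv fy]]]] maxN.
pose B z := \matrix_(i < N) v i z.
(* a constant right inverse of [B y] makes [B z *m C] a square matrix that is
   invertible for [z] near [y], which avoids selecting a minor of [B] *)
pose C := pinvmx (B y).
have rB z i l : B z i l = v i z 0 l by rewrite mxE.
have rBC W : W `<=` V0 -> forall i l, regular_on W (fun z => (B z *m C) i l).
  move=> WV i l; apply: (@regular_on_ext _ _ _ (fun z => \sum_e v i z 0 e * C e l)).
    by move=> z _; rewrite mxE; apply: eq_bigr => e _; rewrite rB.
  apply: regular_on_sum => e _; apply: regular_onM; last exact: regular_on_cst.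
  exact: regular_on_sub WV (rs_regular rsM (Mv i) e).
have [V [Vy VV0 detV]] : exists V, [/\ V y, V `<=` V0 &
    forall z, V z -> \det (B z *m C) != 0].
  apply: regular_nonzero_near => //.
    by apply: regular_on_det => i l; exact: rBC.
  by rewrite /C mulmxVp // det1 oner_neq0.
exists V, N, v; split; first by exists y.
- exact: subset_trans VV0 V0U.
- by move=> i; exact: (rs_res rsM VV0 (Mv i)).
move=> W t WV MWt.
pose c z := t z *m C *m invmx (B z *m C).
exists (fun i z => c z 0 i); split.
  move=> i; apply: (@regular_on_ext _ _ _ (fun z => (\det (B z *m C))^-1 *
    \sum_l (\sum_e t z 0 e * C e l) * cofactor (B z *m C) i l)).
    move=> z Wz; rewrite /c /invmx unitmxE unitfE detV; last exact: WV.
    rewrite -scalemxAr mxE; congr (_ * _); rewrite mxE; apply: eq_bigr => l _.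
    by rewrite [(\adj _) _ _]mxE; congr (_ * _); rewrite mxE.
  have WV0 := subset_trans WV VV0.
  apply: regular_onM.
    apply: regular_onV; last by move=> z /WV /detV.
    by apply: regular_on_det => a b; exact: rBC.
  apply: regular_on_sum => l _; apply: regular_onM.
    apply: regular_on_sum => e _; apply: regular_onM; last exact: regular_on_cst.
    exact: (rs_regular rsM MWt).
  apply: regular_onM; first exact: regular_on_cst.
  apply: regular_on_det => a b; rewrite /row' /col'.
  by apply: regular_on_ext (rBC _ WV0 (lift i a) (lift l b)) => z _; rewrite !mxE.
move=> z Wz; have uBC : B z *m C \in unitmx by rewrite unitmxE unitfE detV //; exact: WV.
have fz : row_free (B z).
  by rewrite -row_leq_rank -{1}(mxrank_unit uBC) mxrankM_maxl.
have tz : (t z <= B z)%MS.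
  have H : ~~ row_free (col_mx (B z) (t z)).
    apply/negP => fBt; suff /maxN : `[< free (N + 1)%N >] by rewrite addn1 ltnn.
    apply/asboolP; exists W, z, (fcat v (fun=> t)); split=> //.
      exact: (rs_sub rsM MWt).
      by apply: fcatP => // i; apply: (rs_res rsM _ (Mv i)) => u /WV /VV0.
    rewrite (_ : \matrix_i _ = col_mx (B z) (t z)) //.
    apply/matrixP => i l; case: (fintype.splitP i) => a ia.
      have -> : i = lshift 1 a by apply: val_inj.
      by rewrite col_mxEu !mxE fcatl.
    have -> : i = rshift N a by apply: val_inj.
    by rewrite col_mxEd !mxE fcatr ord1.
  apply: contraNT H => ntB; rewrite -row_leq_rank -addsmxE.
  rewrite addn1 -{1}(eqP fz) ltn_neqAle mxrankS ?addsmxSl // andbT.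
  by rewrite (mxrank_leqif_sup (addsmxSl _ _)) addsmx_sub submx_refl.
have /submxP[u uE] := tz.
have cE : c z = u by rewrite /c uE -[u *m _ *m _]mulmxA mulmxK.
by rewrite uE cE mulmx_sum_row; apply: eq_bigr => i _; rewrite rowK.
Qed.

(** In an affine chart around [x] every germ of [M] becomes, after multiplication
by an invertible germ, a row of dehomogenized polynomials.  The polynomial rows
that give germs of [M] form a submodule of a noetherian module. *)
Lemma stalk_finitely_generated x : U0 x ->
  exists V N (s : 'I_N -> proj k n -> 'rV[k]_r),
  [/\ V x, V `<=` U0, forall i, M V (s i) &
    forall W t, W x -> M W t -> exists W' (c : 'I_N -> proj k n -> k),
      [/\ W' x, W' `<=` W, W' `<=` V, forall i, regular_on W' (c i) &
        forall y, W' y -> t y = \sum_i c i y *: s i y]].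
Proof.
move=> U0x; have [j xj] := coord_neq0 x.
have [Dj DjE] := opens_coord X j.
have Djx : Dj x by rewrite DjE; split=> //; exact: opens_sub U0x.
pose affrow (P : 'rV[{mpoly k[n.+1]}]_r) y : 'rV[k]_r := \row_i affeval j (P 0 i) y.
pose I : set 'rV[{mpoly k[n.+1]}]_r :=
  [set P | exists2 V : opens X, V x & V `<=` Dj /\ M V (affrow P)].
have raff W p : W `<=` Dj -> regular_on W (affeval j p).
  by move=> WD; apply: regular_on_affeval => y /WD; rewrite DjE => -[].
have [|N [g [Ig gen]]] := @noetherian_rV _ r (@noetherian_mpoly k n.+1) I.
  split.
    exists (opensI U0 Dj); split=> //; first exact: subIsetr.
    apply: (rs_ext rsM _ (rs0 rsM (@opensIl U0 Dj))) => y _.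
    by apply/rowP => i; rewrite !mxE /affeval meval0.
  move=> a P Q [V Vx [VD MP]] [W Wx [WD MQ]].
  exists (opensI V W); split=> //; first by move=> y /= [/VD].
  have M1 := rs_res rsM (@opensIl V W) MP.
  have M2 := rs_res rsM (@opensIr V W) MQ.
  have ra : regular_on (opensI V W) (affeval j a) by apply: raff => y /= [/VD].
  apply: (rs_ext rsM _ (rsD rsM (rsZ rsM ra M1) M2)) => y _.
  by apply/rowP => i; rewrite !mxE /affeval mevalD mevalM.
have /choice[V VP] : forall i, exists V, V x /\ (V `<=` Dj /\ M V (affrow (g i))).
  by move=> i; have [V] := Ig i; exists V.
have [||V' [V'x V'UD V'V]] := @opens_bigI_point x (opensI U0 Dj) N V.
- by [].
- by move=> i; have [] := VP i.
have V'D : V' `<=` Dj by move=> y /V'UD[].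
exists V', N, (fun i => affrow (g i)); split=> //; first by move=> y /V'UD[].
  by move=> i; have [_ [_]] := VP i; exact: rs_res.
move=> W t Wx Mt.
have [q [p [qx E]]] := common_denominator (rs_regular rsM Mt) Wx xj.
pose W1 := opensI W V'.
have [||W' [W'x W'W1 q0]] := @regular_nonzero_near _ _ _ W1 (affeval j q) x _ _ qx.
- by apply: raff => y /= [_ /V'D].
- by [].
have W'D : W' `<=` Dj by move=> y /W'W1[_ /V'D].
have W'W : W' `<=` W by move=> y /W'W1[].
have Et y : W' y -> affeval j q y *: t y = affrow (\row_i p i) y.
  move=> W'y; apply/rowP => i; rewrite !mxE; apply: E; first exact: W'W.
  by have := W'D y W'y; rewrite DjE => -[].
have [|c cE] := gen (\row_i p i).
  exists W'; [|split=> //; apply: (rs_ext rsM Et)] => //.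
  by apply: (rsZ rsM); [exact: raff | exact: (rs_res rsM W'W)].
exists W', (fun i y => (affeval j q y)^-1 * affeval j (c i) y); split=> //.
- by move=> y /W'W1[].
- move=> i; apply: regular_onM; last exact: raff.
  by apply: regular_onV => //; exact: raff.
move=> y W'y; apply: (scalerI (q0 y W'y)); rewrite (Et y W'y) cE scaler_sumr.
apply/rowP => l; rewrite !mxE !summxE /affeval rmorph_sum; apply: eq_bigr => i _ /=.
rewrite !mxE rmorphM /= -!/(affeval _ _ _).
by rewrite mulrA mulrA divff ?mul1r // q0.
Qed.

(** Generators at the points of a nonempty open set and generators at [x] give
generators on the union of the open set with [x], which is open since the
topology is cofinite. *)
Lemma row_submodule_finite_type x : generically_extends -> U0 x ->
  exists W N (s : 'I_N -> proj k n -> 'rV[k]_r),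
  [/\ W x, W `<=` U0, forall i, M W (s i) &
    forall V t y, V `<=` W -> M V t -> V y ->
      exists V' (c : 'I_N -> proj k n -> k),
      [/\ V' y, V' `<=` V, forall i, regular_on V' (c i) &
        forall z, V' z -> t z = \sum_i c i z *: s i z]].
Proof.
move=> gext U0x.
have [|V1 [N [v [V10 V1U Mv genv]]]] := generic_generators; first by exists x.
have [V2 [q [s [V2x V2U Ms gens]]]] := stalk_finitely_generated U0x.
have /choice[w /choice[W /choice[V' /choice[c wP]]]] : forall i, exists w W V' c,
    [/\ W x, M W w, V' !=set0, V' `<=` W & V' `<=` V1] /\
    (regular_on V' c /\ forall y, V' y -> v i y = c y *: w y).
  move=> i; have [W [V' [w [c H]]]] := gext _ _ x (Mv i) V10 U0x.
  by exists w, W, V', c.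
have [||W3 [W3x W3V2 W3W]] := @opens_bigI_point x V2 N W.
- by [].
- by move=> i; have [[]] := wP i.
have [||V4 [V40 V4sub V4V']] := @opens_bigI_neq0 (opensI V1 W3) N V'.
- by apply: opensI_neq0 => //; exists x.
- by move=> i; have [[]] := wP i.
(* [V4] avoids the points where the [w i] fail to generate *)
have [||W5 W5E] := @opens_of_supset _ _ X V4 (V4 `|` [set x]) V40.
- exact: subsetUl.
- by move=> y [/opens_sub|->] //; exact: opens_sub U0x.
have W5W3 : W5 `<=` W3 by rewrite W5E => y [/V4sub[]|->].
exists W5, (N + q)%N, (fcat w s); split.
- by rewrite W5E; right.
- by move=> y /W5W3 /W3V2 /V2U.
- apply: fcatP => i; apply: (rs_res rsM) (subset_trans W5W3 _) _.
  + exact: (W3W i).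
  + by have [[]] := wP i.
  + exact: W3V2.
  + exact: Ms.
move=> V t y VW5 Mt Vy.
have [V4y|nV4y] := pselect (V4 y).
  have V1V : opensI V V4 `<=` V1 by move=> z /= [_ /V4sub[]].
  have Mt' := rs_res rsM (@opensIl V V4) Mt.
  have [a [ra aE]] := genv _ _ V1V Mt'.
  exists (opensI V V4), (fcat (fun i z => a i z * c i z) (fun=> fun=> 0)); split.
  - by [].
  - exact: subIsetl.
  - apply: fcatP => i; last exact: regular_on_cst.
    apply: regular_onM => //; have [_ [rc _]] := wP i.
    by apply: regular_on_sub rc => z /= [_ /(V4V' i)].
  - move=> z /= [Vz V4z]; rewrite aE // big_split_ord /= [X in _ = _ + X]big1.
      rewrite addr0; apply: eq_bigr => i _; rewrite !fcatl.
      by have [_ [_ ->]] := wP i; [rewrite scalerA | exact: (V4V' i)].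
    by move=> i _; rewrite !fcatr scale0r.
have yx : y = x by have := VW5 y Vy; rewrite W5E => -[].
rewrite {}yx in Vy *; have [W' [a [W'x W'V _ ra aE]]] := gens V t Vy Mt.
exists W', (fcat (fun=> fun=> 0) a); split=> //.
  by apply: fcatP => i //; exact: regular_on_cst.
move=> z W'z; rewrite aE // big_split_ord /= [X in _ = X + _]big1 ?add0r.
  by apply: eq_bigr => i _; rewrite !fcatr.
by move=> i _; rewrite !fcatl scale0r.
Qed.

End Core.

(** * Subsheaves of a vector bundle and their pullbacks to rows *)

Section TotalExtension.
Variables (k : closedFieldType) (n : nat).
Implicit Types (A B : set (proj k n)).

(** Outside its domain a regular function is extended by 0: the extension is then
additive and multiplicative everywhere. *)
Definition tot A (c : regfun A) (y : proj k n) : k :=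
  if pselect (A y) is left Ay then c (SigSub (mem_set Ay)) else 0.

Lemma tot_val A (c : regfun A) (y : A) : tot c (val y) = c y.
Proof.
rewrite /tot; case: pselect => [Ay|]; last by case; exact: set_valP.
by congr (regval c _); exact: val_inj.
Qed.

Lemma totE A (c : regfun A) y (Ay : A y) : tot c y = c (SigSub (mem_set Ay)).
Proof. by rewrite -tot_val. Qed.

Lemma regular_on_tot A (c : regfun A) : regular_on A (tot c).
Proof.
have := asboolW (regvalP c); rewrite /regular_on.
by rewrite (_ : (fun y => tot c (val y)) = c) //; apply: funext => y; exact: tot_val.
Qed.

Definition regfun_of A f (rf : regular_on A f) : regfun A := RegFun (asboolT rf).

Lemma tot_regfun_of A f (rf : regular_on A f) y : A y -> tot (regfun_of rf) y = f y.
Proof. by move=> Ay; rewrite totE. Qed.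

Lemma regfun_eq A (c d : regfun A) : (forall y, A y -> tot c y = tot d y) -> c = d.
Proof.
move=> cd; apply: val_inj; apply: funext => y.
by rewrite -[LHS]tot_val -[RHS]tot_val; apply: cd; exact: set_valP.
Qed.

Lemma tot_res A B (AB : A `<=` B) (c : regfun B) y : A y -> tot (regres AB c) y = tot c y.
Proof.
move=> Ay; rewrite (totE _ Ay) (totE _ (AB y Ay)) /=.
by congr (regval c _); exact: val_inj.
Qed.

Lemma tot0 A y : tot (0 : regfun A) y = 0.
Proof. by rewrite /tot; case: pselect. Qed.

Lemma totD A (c d : regfun A) y : tot (c + d) y = tot c y + tot d y.
Proof. by rewrite /tot; case: pselect => // _; rewrite addr0. Qed.

Lemma totM A (c d : regfun A) y : tot (c * d) y = tot c y * tot d y.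
Proof. by rewrite /tot; case: pselect => // _; rewrite mulr0. Qed.

Lemma tot_sum A (I : Type) (r : seq I) (P : pred I) (F : I -> regfun A) y :
  tot (\sum_(i <- r | P i) F i) y = \sum_(i <- r | P i) tot (F i) y.
Proof. by apply: (big_morph (fun c => tot c y)) => [c d|]; rewrite ?totD ?tot0. Qed.

End TotalExtension.

Section SheafLemmas.
Variables (k : closedFieldType) (n : nat) (X : smooth_projective_curve k n).
Variable (E : sheaf X).
Implicit Types (U V W : opens X).

Lemma res0 U V (VU : V `<=` U) : res VU (0 : E U) = 0.
Proof. by rewrite -(scale0r (0 : E U)) resZ rmorph0 scale0r. Qed.

Lemma res_sum U V (VU : V `<=` U) (I : Type) (r : seq I) (P : pred I) (F : I -> E U) :
  res VU (\sum_(i <- r | P i) F i) = \sum_(i <- r | P i) res VU (F i).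
Proof. by apply: big_morph => [s t|]; [exact: resD | exact: res0]. Qed.

Lemma res_comb U V (VU : V `<=` U) r (c : 'I_r -> regfun U) (e : 'I_r -> E U) :
  res VU (\sum_i c i *: e i) = \sum_i regres VU (c i) *: res VU (e i).
Proof. by rewrite res_sum; apply: eq_bigr => i _; rewrite resZ. Qed.

Lemma subsheaf_sum (F : subsheaf E) U (I : Type) (r : seq I) (P : pred I) (s : I -> E U) :
  (forall i, P i -> F U (s i)) -> F U (\sum_(i <- r | P i) s i).
Proof.
by move=> Fs; elim/big_ind: _ => //; [exact: subsheaf0 | exact: subsheafD].
Qed.

(** The coefficients of [s] and [t] in a local basis are regular functions that
agree on a nonempty open set, hence everywhere, being fractions of forms. *)
Lemma section_identity (vbE : vector_bundle E) U V (VU : V `<=` U) (s t : E U) :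
  V !=set0 -> res VU s = res VU t -> s = t.
Proof.
move=> V0 st; apply: sheaf_separated => x Ux.
have [W Wx [r [e basis]]] := vbE x (opens_sub Ux).
pose W' := opensI U W.
have W'U : W' `<=` U by exact: opensIl.
have W'W : W' `<=` W by exact: opensIr.
exists W', W'U; split; first by split.
have [c [cE _]] := basis W' W'W (res W'U s).
have [d [dE _]] := basis W' W'W (res W'U t).
pose V' := opensI V W'.
have V'V : V' `<=` V by exact: opensIl.
have V'W' : V' `<=` W' by exact: opensIr.
have V'0 : V' !=set0 by apply: opensI_neq0 => //; exists x; split.
have V'W := subset_trans V'W' W'W.
have V'U := subset_trans V'V VU.
have [b [_ uniqb]] := basis V' V'W (res V'U s).
have resE (a : {ffun 'I_r -> regfun W'}) u : res W'U u = \sum_i a i *: res W'W (e i) ->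
    res V'U u = \sum_i ([ffun i => regres V'W' (a i)] :
      {ffun 'I_r -> regfun V'}) i *: res V'W (e i).
  move=> uE; rewrite -(res_comp W'U V'W') uE res_comb.
  by apply: eq_bigr => i _; rewrite ffunE (res_comp _ _ V'W).
have cd i : regres V'W' (c i) = regres V'W' (d i).
  have Ec := uniqb _ (resE c s cE).
  have stV' : res V'U s = res V'U t by rewrite -!(res_comp VU V'V) st.
  have Ed : b = [ffun i => regres V'W' (d i)].
    by apply: uniqb; rewrite stV'; exact: resE.
  by have := congr1 (fun f : {ffun _ -> _} => f i) (etrans (esym Ec) Ed); rewrite !ffunE.
rewrite cE dE; apply: eq_bigr => i _; congr (_ *: _).
apply: regfun_eq => y W'y.
have [y' V'y'] := V'0.
have Xy := opens_sub W'y.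
have rB := regular_onB (regular_on_tot (c i)) (regular_on_tot (d i)).
have [m [p [q [hp hq qy F]]]] := regular_quotient rB W'y.
have p0 : peval p y = 0.
  apply: (dhomog_identity hp V'0) Xy => z V'z.
  rewrite -F; last exact: (V'W' z).
  by rewrite -!(tot_res V'W' _ V'z) cd subrr mulr0.
apply/eqP; rewrite -subr_eq0; have /eqP := F y W'y.
by rewrite p0 mulf_eq0 (negPf qy).
Qed.

(** A combination on the small open set [V] is required, but of sections defined
on a neighbourhood [W] of [x]; [V] need not contain [x]. *)
Definition generically_generated_at U (F : subsheaf E) (t : E U) x : Prop :=
  exists W V (VW : V `<=` W) (VU : V `<=` U) N (s : 'I_N -> E W) (c : 'I_N -> regfun V),
    [/\ W x, V !=set0, forall i, F W (s i) & res VU t = \sum_i c i *: res VW (s i)].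

Definition generically_generated (F : subsheaf E) : Prop :=
  forall U (t : E U) x, F U t -> U !=set0 -> X x -> generically_generated_at F t x.

Lemma finite_type_generically_generated (F : subsheaf E) :
  finite_type F -> generically_generated F.
Proof.
move=> ftF V t x Ft V0 Xx; have [U Ux [r [s [Fs gen]]]] := ftF x Xx.
have [|y UVy] := opensI_neq0 (_ : U !=set0) V0; first by exists x.
have [W [WUV [Wy [c cE]]]] := gen _ (@opensIl _ _ _ U V) _
  (subsheaf_res (@opensIr _ _ _ U V) Ft) y UVy.
have WU := subset_trans WUV (@opensIl _ _ _ U V).
have WV := subset_trans WUV (@opensIr _ _ _ U V).
exists U, W, WU, WV, r, s, c; split=> //; first by exists y.
rewrite -(res_comp (@opensIr _ _ _ U V) WUV) cE.
by apply: eq_bigr => i _; rewrite (res_comp _ _ WU).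
Qed.

Variables (U : opens X) (r : nat) (e : 'I_r -> E U) (T : subsheaf E).

(** The sections of [T] seen through the morphism from the free module of rank
[r] to [E] given by [e].  When [e] is a basis this is [T] restricted to [U]; when [T] is
the zero subsheaf it is the module of relations between the [e i]. *)
Definition pullback V : set (proj k n -> 'rV[k]_r) :=
  [set t | exists (VU : V `<=` U) (c : 'I_r -> regfun V),
    (forall i y, V y -> t y 0 i = tot (c i) y) /\ T V (\sum_i c i *: res VU (e i))].

Lemma pullback_row_submodule : row_submodule U pullback.
Proof.
split.
- by move=> V t [VU _].
- move=> V t [VU [c [tc _]]] i; apply: regular_on_ext (regular_on_tot (c i)) => y Vy.
  by rewrite tc.
- move=> V VU; exists VU, (fun=> 0); split=> [i y _|]; first by rewrite mxE tot0.
  by rewrite big1 => [|i _]; [exact: subsheaf0 | rewrite scale0r].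
- move=> V s t [VU [c [sc Tc]]] [VU' [d [td Td]]].
  exists VU, (fun i => c i + d i); split=> [i y Vy|].
    by rewrite mxE totD sc ?td.
  under eq_bigr do rewrite scalerDl.
  rewrite big_split; apply: subsheafD => //.
  by rewrite (Prop_irrelevance VU VU').
- move=> V f t rf [VU [c [tc Tc]]].
  exists VU, (fun i => regfun_of rf * c i); split=> [i y Vy|].
    by rewrite mxE totM tot_regfun_of ?tc.
  under eq_bigr do rewrite -scalerA.
  by rewrite -scaler_sumr; apply: subsheafZ.
- move=> V W t WV [VU [c [tc Tc]]].
  exists (subset_trans WV VU), (fun i => regres WV (c i)); split=> [i y Wy|].
    by rewrite tot_res // tc //; exact: WV.
  have := subsheaf_res WV Tc; rewrite res_comb.
  by under eq_bigr do rewrite (res_comp _ _ (subset_trans WV VU)).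
- move=> V s t st [VU [c [sc Tc]]]; exists VU, c; split=> // i y Vy.
  by rewrite -st // sc.
Qed.

Hypotheses (vbE : vector_bundle E) (genT : generically_generated T).

(** Near [x], a multiple of the row [c] by a common denominator [q] becomes
regular, and so do the coefficients [b] of the generators [s] of [T].  The
relation between both combinations holds generically, hence near [x], and it
shows that the new row is a section of the pullback defined near [x]. *)
Lemma pullback_generically_extends : generically_extends U pullback.
Proof.
move=> V t x [VU [c [tc Tc]]] V0 Ux.
have [W [V' [V'W [V'V [N [s [b [Wx V'0 Ts sE]]]]]]]] := genT Tc V0 (opens_sub Ux).
have [j xj] := coord_neq0 x.
have [Dj DjE] := opens_coord X j.
have Djx : Dj x by rewrite DjE; split=> //; exact: opens_sub Ux.
have Djj y : Dj y -> sval y 0 j != 0 by rewrite DjE => -[].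
pose W1 := opensI (opensI W Dj) U; pose V2 := opensI V' Dj.
have W1D : W1 `<=` Dj by move=> y [[]].
have W1W : W1 `<=` W by move=> y [[]].
have W1U : W1 `<=` U by exact: opensIr.
have V2V' : V2 `<=` V' by exact: opensIl.
have V2V := subset_trans V2V' V'V.
have V2W1 : V2 `<=` W1.
  by move=> y [V'y Dy]; split; [split=> //; exact: (V'W y) | exact: (VU _ (V'V _ V'y))].
have V20 : V2 !=set0 by apply: opensI_neq0 => //; exists x.
have [y V2y] := V20.
have rcb : forall i, regular_on V2 (fcat (fun i => tot (c i)) (fun i => tot (b i)) i).
  apply: fcatP => i; first exact: regular_on_sub V2V (regular_on_tot (c i)).
  exact: regular_on_sub V2V' (regular_on_tot (b i)).
have [q [p [qy pE]]] := common_denominator rcb V2y (Djj y (W1D _ (V2W1 _ V2y))).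
have raff V3 P : V3 `<=` Dj -> regular_on V3 (affeval j P).
  by move=> V3D; apply: regular_on_affeval => z /V3D /Djj.
have rW1 P := raff W1 P W1D.
have V2D := subset_trans V2W1 W1D.
pose a i : regfun W1 := regfun_of (rW1 (p (lshift N i))).
pose d i : regfun W1 := regfun_of (rW1 (p (rshift r i))).
pose qV2 : regfun V2 := regfun_of (raff V2 q V2D).
have aE i : regres V2W1 (a i) = qV2 * regres V2V (c i).
  apply: regfun_eq => z V2z; have W1z := V2W1 _ V2z.
  rewrite totM !tot_res // !tot_regfun_of //.
  by rewrite -pE ?fcatl //; exact: Djj (V2D _ V2z).
have dE i : regres V2W1 (d i) = qV2 * regres V2V' (b i).
  apply: regfun_eq => z V2z; have W1z := V2W1 _ V2z.
  rewrite totM !tot_res // !tot_regfun_of //.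
  by rewrite -pE ?fcatr //; exact: Djj (V2D _ V2z).
have adE : \sum_i a i *: res W1U (e i) = \sum_i d i *: res W1W (s i).
  apply: (section_identity vbE (VU := V2W1)) V20 _.
  have V2U := subset_trans V2V VU; have V2W := subset_trans V2V' V'W.
  rewrite !res_comb.
  under eq_bigr do rewrite aE (res_comp _ _ V2U) -(res_comp VU V2V) -scalerA -resZ.
  under [RHS]eq_bigr do rewrite dE (res_comp _ _ V2W) -(res_comp V'W V2V') -scalerA -resZ.
  rewrite -!scaler_sumr -!res_sum -sE; congr (_ *: _).
  by rewrite (res_comp _ _ V2V).
have [V3 [V3y V3V2 q0]] := regular_nonzero_near (raff V2 q V2D) V2y qy.
exists W1, V3, (fun z => \row_i affeval j (p (lshift N i)) z), (fun z => (affeval j q z)^-1).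
split; split=> //.
- exists W1U, a; split=> [i z W1z|]; first by rewrite mxE tot_regfun_of.
  rewrite adE; apply: subsheaf_sum => i _; apply: subsheafZ.
  exact: subsheaf_res.
- by exists y.
- exact: subset_trans V3V2 V2W1.
- exact: subset_trans V3V2 V2V.
- exact: regular_onV (raff V3 q (subset_trans V3V2 V2D)) q0.
move=> z V3z; have V2z := V3V2 _ V3z; apply/rowP => i; rewrite !mxE.
rewrite -pE // ?fcatl; last exact: Djj (V2D _ V2z).
by rewrite mulKf ?q0 // tc //; exact: (V2V z).
Qed.

Lemma pullback_finite_type x : U x -> exists (W : opens X) (WU : W `<=` U), W x /\
  exists (q : nat) (rho : 'I_q -> 'I_r -> regfun W),
    (forall j, T W (\sum_i rho j i *: res WU (e i))) /\
    forall V (VW : V `<=` W) (c : 'I_r -> regfun V),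
      T V (\sum_i c i *: res VW (res WU (e i))) ->
      locally (fun V' (V'V : V' `<=` V) => exists b : 'I_q -> regfun V',
        forall i, regres V'V (c i) =
          \sum_j b j * regres V'V (regres VW (rho j i))).
Proof.
move=> Ux; have [W [q [s [Wx WU Ms gen]]]] :=
  row_submodule_finite_type pullback_row_submodule pullback_generically_extends Ux.
have /choice[rho rhoP] : forall j, exists rho : 'I_r -> regfun W,
    (forall i y, W y -> s j y 0 i = tot (rho i) y) /\
    T W (\sum_i rho i *: res WU (e i)).
  move=> j; have [WU' [rho [sr Tr]]] := Ms j; exists rho.
  by rewrite (Prop_irrelevance WU WU').
exists W, WU; split=> //; exists q, rho; split=> [j|]; first by case: (rhoP j).
move=> V VW c Tc y Vy.
have [|V' [b [V'y V'V rb bE]]] := gen V (fun z => \row_i tot (c i) z) y VW _ Vy.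
  exists (subset_trans VW WU), c; split=> [i z _|]; first by rewrite mxE.
  by move: Tc; under eq_bigr do rewrite (res_comp _ _ (subset_trans VW WU)).
exists V', V'V; split=> //; exists (fun j => regfun_of (rb j)) => i.
apply: regfun_eq => z V'z; have Vz := V'V _ V'z.
rewrite tot_res // tot_sum; have := congr1 (fun f : 'rV_r => f 0 i) (bE z V'z).
rewrite mxE => ->; rewrite summxE; apply: eq_bigr => j _.
rewrite mxE totM tot_regfun_of // !tot_res //.
by case: (rhoP j) => -> //; exact: (VW z).
Qed.

End SheafLemmas.

(** * Sums of subsheaves, coherence and connections *)

Section Coherence.
Variables (k : closedFieldType) (n : nat) (X : smooth_projective_curve k n).
Variable (E : sheaf X).
Implicit Types (U V W : opens X) (F G : subsheaf E).

Lemma subsheaf_ext F G : (forall U, F U = G U) -> F = G.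
Proof.
case: F => F F1 F2 F3 F4 F5; case: G => G G1 G2 G3 G4 G5 /= FG.
have {}FG : F = G by apply: functional_extensionality_dep.
subst G; congr Subsheaf; exact: Prop_irrelevance.
Qed.

Lemma zero_sectionD U (s t : E U) : s = 0 -> t = 0 -> s + t = 0.
Proof. by move=> -> ->; rewrite addr0. Qed.

Lemma zero_sectionZ U (f : regfun U) (s : E U) : s = 0 -> f *: s = 0.
Proof. by move=> ->; exact: scaler0. Qed.

Lemma zero_section_res U V (VU : V `<=` U) (s : E U) : s = 0 -> res VU s = 0.
Proof. by move=> ->; exact: res0. Qed.

Lemma zero_section_local U (s : E U) :
  locally (fun V (VU : V `<=` U) => res VU s = 0) -> s = 0.
Proof.
move=> s0; apply: sheaf_separated => x Ux; have [V [VU [Vx VE]]] := s0 x Ux.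
by exists V, VU; rewrite res0.
Qed.

Definition zero_subsheaf : subsheaf E :=
  @Subsheaf _ _ X E (fun U => [set 0]) (fun=> erefl) zero_sectionD zero_sectionZ
    zero_section_res zero_section_local.

Hypothesis vbE : vector_bundle E.

Lemma zero_generically_generated : generically_generated zero_subsheaf.
Proof.
move=> U t x -> U0 Xx; have [W WE] := opens_of_zopen X (@zopenT k n).
have UW : U `<=` W by rewrite WE setIT; exact: opens_sub.
exists W, U, UW, (@subset_refl _ U), 0%N, (fun=> 0), (fun=> 0); split=> //.
- by rewrite WE.
- by rewrite big_ord0 res0.
Qed.

(** Finite type is [pullback_finite_type] for a local basis of [E]; the
finiteness of the relations between sections [s] is [pullback_finite_type]
for [s] and the zero subsheaf. *)
Lemma generically_generated_coherent F : generically_generated F -> coherent F.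
Proof.
move=> genF; split=> [x Xx|U r s Fs x Ux].
  have [U Ux [r [e basis]]] := vbE Xx.
  have [W [WU [Wx [q [rho [Frho gen]]]]]] := pullback_finite_type e vbE genF Ux.
  exists W => //; exists q, (fun j => \sum_i rho j i *: res WU (e i)); split=> //.
  move=> V VW t Ft y Vy; have VU := subset_trans VW WU.
  have [c [cE _]] := basis V VU t.
  have [|V' [V'V [V'y [b bE]]]] := gen V VW c _ y Vy.
    by under eq_bigr do rewrite (res_comp _ _ VU); rewrite -cE.
  exists V', V'V; split=> //; exists b; rewrite cE res_comb.
  under eq_bigr do rewrite bE scaler_suml.
  rewrite exchange_big; apply: eq_bigr => j _.
  rewrite !res_comb scaler_sumr; apply: eq_bigr => i _.
  by rewrite scalerA (res_comp _ _ VU).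
have [W [WU [Wx [q [rho [rho0 gen]]]]]] :=
  pullback_finite_type s vbE zero_generically_generated Ux.
by exists W, WU; split=> //; exists q, rho.
Qed.

Section Sum.
Variable P : subsheaf E -> Prop.

(** Summands are added one at a time, so that additive properties of the sum are
proved by induction. *)
Inductive sum_sections U : E U -> Prop :=
| SumZero : sum_sections 0
| SumAdd G s t : P G -> G U s -> sum_sections t -> sum_sections (s + t).

Lemma sum_sectionsD U (s t : E U) :
  sum_sections s -> sum_sections t -> sum_sections (s + t).
Proof.
move=> + Pt; elim=> [|G u v PG Gu _ IH]; first by rewrite add0r.
by rewrite -addrA; exact: SumAdd PG Gu IH.
Qed.

Lemma sum_sectionsZ U (f : regfun U) (s : E U) :
  sum_sections s -> sum_sections (f *: s).
Proof.
elim=> [|G u v PG Gu _ IH]; first by rewrite scaler0; exact: SumZero.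
by rewrite scalerDr; apply: SumAdd PG _ IH; exact: subsheafZ.
Qed.

Lemma sum_sections_res U V (VU : V `<=` U) (s : E U) :
  sum_sections s -> sum_sections (res VU s).
Proof.
elim=> [|G u v PG Gu _ IH]; first by rewrite res0; exact: SumZero.
by rewrite resD; apply: SumAdd PG _ IH; exact: subsheaf_res.
Qed.

Definition local_sums U : set (E U) :=
  [set s | locally (fun V (VU : V `<=` U) => sum_sections (res VU s))].

Lemma local_sums0 U : local_sums (0 : E U).
Proof.
by move=> x Ux; exists U, (@subset_refl _ U); rewrite res0; split=> //; exact: SumZero.
Qed.

Lemma local_sumsD U (s t : E U) : local_sums s -> local_sums t -> local_sums (s + t).
Proof.
move=> Ps Pt x Ux; have [V [VU [Vx PV]]] := Ps x Ux; have [W [WU [Wx PW]]] := Pt x Ux.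
have VWU := subset_trans (@opensIl _ _ _ V W) VU.
exists (opensI V W), VWU; split=> //; rewrite resD.
rewrite -(res_comp VU (@opensIl _ _ _ V W)) -(res_comp WU (@opensIr _ _ _ V W)).
by apply: sum_sectionsD; exact: sum_sections_res.
Qed.

Lemma local_sumsZ U (f : regfun U) (s : E U) : local_sums s -> local_sums (f *: s).
Proof.
move=> Ps x Ux; have [V [VU [Vx PV]]] := Ps x Ux.
by exists V, VU; split=> //; rewrite resZ; exact: sum_sectionsZ.
Qed.

Lemma local_sums_res U V (VU : V `<=` U) (s : E U) :
  local_sums s -> local_sums (res VU s).
Proof.
move=> Ps x Vx; have [W [WU [Wx PW]]] := Ps x (VU x Vx).
exists (opensI V W), (@opensIl _ _ _ V W); split=> //.
rewrite (res_comp _ _ (subset_trans (@opensIr _ _ _ V W) WU)).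
rewrite -(res_comp WU (@opensIr _ _ _ V W)); exact: sum_sections_res.
Qed.

Lemma local_sums_local U (s : E U) :
  locally (fun V (VU : V `<=` U) => local_sums (res VU s)) -> local_sums s.
Proof.
move=> Ps x Ux; have [V [VU [Vx PV]]] := Ps x Ux.
have [W [WV [Wx PW]]] := PV x Vx.
by exists W, (subset_trans WV VU); rewrite -(res_comp VU WV).
Qed.

Definition sum_subsheaf : subsheaf E :=
  Subsheaf local_sums0 local_sumsD local_sumsZ local_sums_res local_sums_local.

Lemma sum_sections_local U (s : E U) : sum_sections s -> local_sums s.
Proof.
by move=> Ps x Ux; exists U, (@subset_refl _ U); rewrite res_id.
Qed.

Lemma sum_subsheaf_ge G : P G -> subsheaf_le G sum_subsheaf.
Proof.
move=> PG U s Gs; apply: sum_sections_local.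
by rewrite -[s]addr0; apply: SumAdd PG Gs _; exact: SumZero.
Qed.

End Sum.

Lemma generically_generated_atW F G U (t : E U) x : subsheaf_le F G ->
  generically_generated_at F t x -> generically_generated_at G t x.
Proof.
move=> FG [W [V [VW [VU [N [s [c [Wx V0 Fs tE]]]]]]]].
by exists W, V, VW, VU, N, s, c; split=> // i; exact: FG.
Qed.

(** Combinations of two families restrict to the intersections of their domains,
which are still nonempty since [X] is irreducible. *)
Lemma generically_generated_atD F U (s t : E U) x :
  generically_generated_at F s x -> generically_generated_at F t x ->
  generically_generated_at F (s + t) x.
Proof.
move=> [W [V [VW [VU [N [a [c [Wx V0 Fa sE]]]]]]]].
move=> [W' [V' [V'W' [V'U [N' [a' [c' [W'x V'0 Fa' tE]]]]]]]].
pose W0 := opensI W W'; pose V1 := opensI V V'.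
have W0W : W0 `<=` W by exact: opensIl.
have W0W' : W0 `<=` W' by exact: opensIr.
have V1V : V1 `<=` V by exact: opensIl.
have V1V' : V1 `<=` V' by exact: opensIr.
have V1W0 : V1 `<=` W0 by move=> y [/VW Wy /V'W' W'y].
have V1U := subset_trans V1V VU.
exists W0, V1, V1W0, V1U, (N + N')%N,
  (fcat (fun i => res W0W (a i)) (fun i => res W0W' (a' i))),
  (fcat (fun i => regres V1V (c i)) (fun i => regres V1V' (c' i))); split=> //.
- exact: opensI_neq0.
- by apply: fcatP => i; exact: subsheaf_res.
rewrite resD big_split_ord /=; congr (_ + _).
  rewrite -(res_comp VU V1V) sE res_comb; apply: eq_bigr => i _.
  rewrite !fcatl (res_comp _ _ (subset_trans V1W0 W0W)).
  by rewrite (res_comp _ _ (subset_trans V1W0 W0W)).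
rewrite -(res_comp V'U V1V') tE res_comb; apply: eq_bigr => i _.
rewrite !fcatr (res_comp _ _ (subset_trans V1W0 W0W')).
by rewrite (res_comp _ _ (subset_trans V1W0 W0W')).
Qed.

(** A section of the sum is only locally a finite sum, but generic generation
may be tested on any nonempty open subset, where finitely many summands
occur. *)
Lemma sum_generically_generated (P : subsheaf E -> Prop) :
  (forall G, P G -> generically_generated G) ->
  generically_generated (sum_subsheaf P).
Proof.
move=> genP U t x Pt [y Uy] Xx; have [V [VU [Vy PV]]] := Pt y Uy.
suff [W [V' [V'W [V'V [N [s [c [Wx V'0 Fs tE]]]]]]]] :
    generically_generated_at (sum_subsheaf P) (res VU t) x.
  exists W, V', V'W, (subset_trans V'V VU), N, s, c; split=> //.
  by rewrite -(res_comp VU V'V).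
have V0 : V !=set0 by exists y.
elim: PV => [|G u v PG Gu _ IH].
  apply: (@generically_generated_atW zero_subsheaf).
    by move=> W s ->; exact: local_sums0.
  exact: zero_generically_generated.
apply: generically_generated_atD IH.
by apply: generically_generated_atW (sum_subsheaf_ge PG) _; exact: genP.
Qed.

End Coherence.

Section Connection.
Variables (k : closedFieldType) (n : nat) (X : smooth_projective_curve k n).
Variables (S : set (proj k n)) (m : nat) (K : cotangent_bundle X) (E : sheaf X).
Variables (EK : tensor_product E K) (EKmS : tensor_product EK (sheaf_of_poles X S m)).
Implicit Types (U V W : opens X) (F G : subsheaf E).

Lemma simple_tensor_res U V (VU : V `<=` U) (e : E U) (w : K U) :
  res VU (simple_tensor EKmS e w) = simple_tensor EKmS (res VU e) (res VU w).
Proof.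
rewrite /simple_tensor -!pairing_res; congr (tens _ _ _ _).
by do 2!apply: val_inj.
Qed.

Lemma in_tensor_cotangent0 F U : in_tensor_cotangent F (0 : EKmS U).
Proof.
move=> x Ux; exists U, (@subset_refl _ U); split=> //.
exists 0%N, (fun=> 0), (fun=> 0); split; first by case.
by rewrite big_ord0 res0.
Qed.

Lemma in_tensor_cotangentD F U (v w : EKmS U) :
  in_tensor_cotangent F v -> in_tensor_cotangent F w -> in_tensor_cotangent F (v + w).
Proof.
move=> Fv Fw x Ux; have [V [VU [Vx [r [e [a [Fe vE]]]]]]] := Fv x Ux.
have [W [WU [Wx [q [f [b [Ff wE]]]]]]] := Fw x Ux.
have IV : opensI V W `<=` V by exact: opensIl.
have IW : opensI V W `<=` W by exact: opensIr.
exists (opensI V W), (subset_trans IV VU); split=> //.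
exists (r + q)%N, (fcat (fun i => res IV (e i)) (fun i => res IW (f i))),
  (fcat (fun i => res IV (a i)) (fun i => res IW (b i))); split.
  by apply: fcatP => i; exact: subsheaf_res.
rewrite resD big_split_ord -(res_comp VU IV) -(res_comp WU IW) vE wE !res_sum /=.
by congr (_ + _); apply: eq_bigr => i _; rewrite !(fcatl, fcatr) simple_tensor_res.
Qed.

Lemma in_tensor_cotangent_local F U (w : EKmS U) :
  locally (fun V (VU : V `<=` U) => in_tensor_cotangent F (res VU w)) ->
  in_tensor_cotangent F w.
Proof.
move=> Fw x Ux; have [V [VU [Vx FV]]] := Fw x Ux.
have [W [WV [Wx FW]]] := FV x Vx.
by exists W, (subset_trans WV VU); rewrite -(res_comp VU WV).
Qed.

Lemma in_tensor_cotangentW F G U (w : EKmS U) : subsheaf_le F G ->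
  in_tensor_cotangent F w -> in_tensor_cotangent G w.
Proof.
move=> FG Fw x Ux; have [V [VU [Vx [r [e [a [Fe wE]]]]]]] := Fw x Ux.
by exists V, VU; split=> //; exists r, e, a; split=> // i; exact: FG.
Qed.

Variable D : singular_connection EKmS.

Lemma sum_induces_connection (P : subsheaf E -> Prop) :
  (forall G, P G -> induces_connection D G) ->
  induces_connection D (sum_subsheaf P).
Proof.
move=> DP U s Ps; apply: in_tensor_cotangent_local => x Ux.
have [V [VU [Vx PV]]] := Ps x Ux; exists V, VU; split=> //.
rewrite -conn_res; elim: PV => [|G u v PG Gu _ IH].
  have -> : D V 0 = 0 by apply: (addrI (D V 0)); rewrite -connD !addr0.
  exact: in_tensor_cotangent0.
rewrite connD; apply: in_tensor_cotangentD IH.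
by apply: in_tensor_cotangentW (sum_subsheaf_ge PG) _; exact: DP.
Qed.

End Connection.

Theorem lemma2p1 (k : closedFieldType) (n : nat) (X : smooth_projective_curve k n)
    (S : set (proj k n)) (SX : S `<=` X) (finS : finite_set S) (m : nat)
    (K : cotangent_bundle X) (E : sheaf X) (vbE : vector_bundle E)
    (EK : tensor_product E K)
    (EKmS : tensor_product EK (sheaf_of_poles X S m))
    (D : singular_connection EKmS) :
  exists! F : subsheaf E,
    maximal_subsheaf (fun G => coherent G /\ induces_connection D G) F.
Proof.
pose P (G : subsheaf E) := coherent G /\ induces_connection D G.
have PF : P (sum_subsheaf P).
  split.
    apply: generically_generated_coherent => //.
    apply: sum_generically_generated => // G [[ftG _] _].
    exact: finite_type_generically_generated.
  by apply: sum_induces_connection => G [].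
exists (sum_subsheaf P); split.
  by split=> // G PG _; exact: sum_subsheaf_ge.
move=> F [PF' maxF]; apply: subsheaf_ext => U; apply/seteqP; split.
  exact: maxF PF (sum_subsheaf_ge PF') U.
exact: sum_subsheaf_ge.
Qed.
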